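(* For every Ferrers board $F$, the maps $\alpha: S_F(231)\to S_F(312)$ and $\beta: S_F(312)\to S_F(231)$ (defined by $S(\alpha(P),F)=S(P,F)^+$ for $P\in S_F(231)$ and $S(\beta(P),F)=S(P,F)^+$ for $P\in S_F(312)$) are inverses of each other, and therefore both are bijections.
   Context: Let $\mathcal{A}$ be an $m\times m$ array of unit squares in the $xy$-plane with its bottom left corner at the origin. The corners of squares are called vertices. For a vertex $V=(a,b)$, $R(V)$ denotes the rectangular array of squares bounded by the lines $x=0$, $x=a$, $y=0$, $y=b$ (empty if $a=0$ or $b=0$). A Ferrers board is a subset $F$ of $\mathcal{A}$ (for some $m$) such that $R(V)\subseteq F$ for each vertex $V$ of $F$ (a vertex of $F$ is a corner of a square of $F$). So $F$ is left- and bottom-justified. The right/up border of $F$ is the border of $F$ excluding the vertical left-hand side and the horizontal bottom side: it is the lattice path of unit rightward and downward steps along the boundary of $F$ from the top left corner $(0,h)$ of $F$ to the bottom right corner $(w,0)$, where $h$ is the length of the longest column and $w$ that of the longest row; both endpoints are vertices of the right/up border. A rook placement on $F$ is a subset of the squares of $F$ (the squares containing ''markers'') with at most one square in each row and at most one in each column of $F$; a full rook placement has exactly one marker in each row and each column of $F$. A rook placement $P$ on $F$ avoids a pattern $\tau$ if for every vertex $V$ on the right/up border of $F$ the permutation order-isomorphic to the restriction of $P$ to $R(V)$ (markers read left to right, by height) avoids $\tau$ in the usual sense (has no subsequence order-isomorphic to $\tau$). $S_F(\tau)$ is the set of all full rook placements on $F$ that avoid $\tau$. For a rook placement $P$ on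 $F$ and a vertex $V$ of $F$, $S(P,V)$ is the maximal length of an increasing sequence of markers of $P$ in $R(V)$ (each successive marker strictly to the right of and strictly above the previous one); it is $0$ if $R(V)$ contains no marker. For a full rook placement $P$, $S(P,F)$ denotes the sequence of values $S(P,V)$ for all vertices $V$ on the right/up border of $F$, in order, starting with the top left corner of $F$. For a vertex $V$ on the right/up border of $F$, the number of markers of $P$ in $R(V)$ is the same for all full rook placements $P$ on $F$; this number is denoted $N(F,V)$. If $P$ is a full rook placement on $F$ and $S=S(P,F)$, then $S^+$ is the sequence of nonnegative integers indexed by the vertices $V$ on the right/up border of $F$ given by $S^+(V)=0$ if $S(V)=0$, and $S^+(V)=N(F,V)+1-S(V)$ otherwise. For $P\in S_F(231)$, $\alpha(P)$ denotes the unique element of $S_F(312)$ such that $S(\alpha(P),F)=S(P,F)^+$. For $P\in S_F(312)$, $\beta(P)$ denotes the unique element of $S_F(231)$ such that $S(\beta(P),F)=S(P,F)^+$. (The existence and uniqueness of these elements are established in the paper, so $\alpha$ and $\beta$ are well defined.) *)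

(* Defs.v *)
(* MathComp *)
From mathcomp Require Import all_boot.

Set Implicit Arguments.
Unset Strict Implicit.
Unset Printing Implicit Defensive.

(* The unit square with corners (i, j) and (i+1, j+1) of the m x m array is the
   pair (i, j): its column is the first component, its row (counted from the
   bottom) the second. *)
Notation square m := ('I_m * 'I_m)%type.

(* A vertex (a, b) is given by its natural-number coordinates. *)
Notation vertex := (nat * nat)%type.

Section Boards.
Variable m : nat.
Implicit Types (F P A : {set square m}) (V : vertex).

Definition rect V : {set square m} :=
  [set s : square m | (s.1 < V.1) && (s.2 < V.2)].

Definition is_vertex F V : bool :=
  [exists s in F, ((V.1 == s.1) || (V.1 == s.1.+1))
               && ((V.2 == s.2) || (V.2 == s.2.+1))].

Definition ferrers F : Prop := forall V, is_vertex F V -> rect V \subset F.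

Definition height F : nat := \max_(i < m) #|[set s in F | s.1 == i]|.
Definition width F : nat := \max_(j < m) #|[set s in F | s.2 == j]|.

Definition has_square F (a b : nat) : bool :=
  [exists s in F, (s.1 == a :> nat) && (s.2 == b :> nat)].

(* From the border vertex (a, b), the path goes right when the square below the
   segment from (a, b) to (a+1, b) lies in F (that segment is then the top edge
   of a column of F), and down otherwise. *)
Definition border_step F V : vertex :=
  if (0 < V.2) && has_square F V.1 V.2.-1 then (V.1.+1, V.2)
  else (V.1, V.2.-1).

(* The vertices of the right/up border, in order from (0, height F) to
   (width F, 0); for the empty board this is the single vertex (0, 0). *)
Definition border F : seq vertex :=
  traject (border_step F) (0, height F) (width F + height F).+1.

Definition rook_placement F P : bool :=
  [&& P \subset F,
      [forall i : 'I_m, #|[set s in P | s.1 == i]| <= 1] &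
      [forall j : 'I_m, #|[set s in P | s.2 == j]| <= 1]].

(* The columns and rows of F are those containing a square of F. *)
Definition full_placement F P : bool :=
  rook_placement F P &&
  [forall s in F, (#|[set t in P | t.1 == s.1]| == 1)
               && (#|[set t in P | t.2 == s.2]| == 1)].

(* The heights of the markers in A, read from left to right. *)
Definition marker_word A : seq nat :=
  [seq nat_of_ord s.2 | s <- sort (fun s t : square m => s.1 <= t.1) (enum A)].

End Boards.

(* For w without repetition, the permutation of 1, ..., size w (in one-line
   notation) that is order-isomorphic to w. *)
Definition standardize (w : seq nat) : seq nat :=
  [seq count (fun y => y <= x) w | x <- w].

Definition order_isomorphic (u v : seq nat) : bool :=
  (size u == size v) &&
  [forall i : 'I_(size u), forall j : 'I_(size u),
     (nth 0 u i < nth 0 u j) == (nth 0 v i < nth 0 v j)].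

Definition contains_pattern (tau w : seq nat) : bool :=
  [exists b : (size w).-tuple bool, order_isomorphic (mask b w) tau].

Definition pattern231 : seq nat := [:: 2; 3; 1].
Definition pattern312 : seq nat := [:: 3; 1; 2].

Section Placements.
Variable m : nat.
Implicit Types (F P : {set square m}) (V : vertex).

Definition avoids F P (tau : seq nat) : bool :=
  all (fun V =>
         ~~ contains_pattern tau (standardize (marker_word (P :&: rect m V))))
      (border F).

(* S_F(tau) *)
Definition avoiders F (tau : seq nat) : {set {set square m}} :=
  [set P | full_placement F P && avoids F P tau].

Definition north_east : rel (square m) :=
  fun s t => (s.1 < t.1) && (s.2 < t.2).

(* S(P, V).  Increasing sequences have no repetition, so the bound on k is
   harmless. *)
Definition max_increasing P V : nat :=
  \max_(k < #|P :&: rect m V|.+1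
        | [exists q : k.-tuple (square m),
             all (mem (P :&: rect m V)) q && sorted north_east q]) k.

(* S(P, F) *)
Definition S_seq F P : seq nat := [seq max_increasing P V | V <- border F].

(* N(F, V): for V on the right/up border, the count does not depend on the
   chosen full placement.  The value 0 is used only if there is none. *)
Definition marker_count F V : nat :=
  if [pick P | full_placement F P] is Some P then #|P :&: rect m V| else 0.

(* S^+, for a sequence S indexed by the vertices of the right/up border.  The
   truncated subtraction is exact, since S(P, V) <= N(F, V). *)
Definition S_plus F (S : seq nat) : seq nat :=
  [seq if x.2 == 0 then 0 else marker_count F x.1 + 1 - x.2
     | x <- zip (border F) S].

(* The unique element of X; set0 if X does not have exactly one element.  On a
   nonempty board set0 is not a full placement, so for X a set of full
   placements the default never belongs to S_F(tau). *)
Definition the_placement (X : {set {set square m}}) : {set square m} :=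
  odflt set0 (unset1 X).

Definition alpha F P : {set square m} :=
  the_placement [set Q in avoiders F pattern312
                 | S_seq F Q == S_plus F (S_seq F P)].

Definition beta F P : {set square m} :=
  the_placement [set Q in avoiders F pattern231
                 | S_seq F Q == S_plus F (S_seq F P)].

End Placements.

(* Main.v *)
(* Along the border, let L_t list the columns of the markers in R(V_t) by
   increasing row.  A right step inserts the new column, which is the largest so
   far, somewhere in L_t; a down step removes the last entry.  P avoids 231 iff
   every L_t avoids 312, and S(P, V_t) is the length lis L_t of a longest
   increasing subsequence.

   Write c_t(j) for lis of the first j entries of L_t.  If inserting at position
   r keeps 312 avoided, the entries after position r decrease, so the insertion
   gives c_(t+1)(j) = c_t(j) for j <= r and c_t(r) + 1 for j > r; conversely
   c_t(j) = min (c_(t+1)(j), S(V_t)), and r is the last jump of c_(t+1).  Hence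
   the process can be run backwards from the labels S alone, which gives
   uniqueness.  A sequence of labels with unit steps is realised as soon as
   S(V) <= S(V') whenever V precedes V' and N >= N(V) between them.

   Transposing the board exchanges 231 and 312 and reverses the border, and the
   labels of a 231-avoiding placement also satisfy S(V) - S(V') <= N(V) - N(V')
   when N >= N(V') between V and V', since c_t(j) only grows with t.  This is the
   realisability condition for S^+ on the reversed border. *)

Require Import Defs.
From mathcomp Require Import all_boot zify.

Set Implicit Arguments.
Unset Strict Implicit.
Unset Printing Implicit Defensive.

(** * Auxiliary facts on subsequences and sorted lists *)

Lemma subseq_cat_inv (T : eqType) (s A B : seq T) :
  subseq s (A ++ B) ->
  exists s1 s2, [/\ s = s1 ++ s2, subseq s1 A & subseq s2 B].
Proof.
case/subseqP => m sz ->.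
have szA : size (take (size A) m) = size A.
  by rewrite size_takel // sz size_cat leq_addr.
exists (mask (take (size A) m) A), (mask (drop (size A) m) B).
by rewrite -mask_cat // cat_take_drop !mask_subseq.
Qed.

Lemma subseq_cons_notin (T : eqType) (x : T) s A B :
  x \notin A -> subseq (x :: s) (A ++ x :: B) -> subseq s B.
Proof.
elim: A => [|y A IH] /=; first by rewrite eqxx.
by rewrite inE negb_or => /andP[/negPf -> xA]; apply: IH.
Qed.

Lemma sorted_ltn_rcons s (x : nat) :
  sorted ltn s -> {in s, forall y, y < x} -> sorted ltn (rcons s x).
Proof.
case: s => [|a s] //= ps lt_x; rewrite rcons_path ps /=.
by apply: lt_x; rewrite mem_last.
Qed.

Lemma take_leq_cat (T : Type) j k (s : seq T) :
  j <= k -> take k s = take j s ++ take (k - j) (drop j s).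
Proof. by move=> jk; rewrite -{1}(subnKC jk) takeD. Qed.

(** * Longest increasing subsequences *)

(** Subsequences are encoded by Boolean masks of the length of [L], a finite type over which the
    maximum can be taken. *)
Definition lis (L : seq nat) : nat :=
  \max_(b : (size L).-tuple bool | sorted ltn (mask b L)) size (mask b L).

Lemma lis_ge L s : subseq s L -> sorted ltn s -> size s <= lis L.
Proof.
case/subseqP => m sz -> srt; have szm : size m == size L by rewrite sz.
exact: (@leq_bigmax_cond _ _ (fun b : (size L).-tuple bool => size (mask b L))
          (Tuple szm)).
Qed.

Lemma lis_ex L : exists s, [/\ subseq s L, sorted ltn s & size s = lis L].
Proof.
pose A := [pred b : (size L).-tuple bool | sorted ltn (mask b L)].
have A0 : 0 < #|A|.
  by apply/card_gt0P; exists [tuple of nseq (size L) false]; rewrite inE /= mask_false.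
have [b bA E] := eq_bigmax_cond (fun b : (size L).-tuple bool => size (mask b L)) A0.
by exists (mask b L); rewrite mask_subseq; split=> //; apply: esym E.
Qed.

Lemma lis_nil : lis [::] = 0.
Proof. by have [s [/size_subseq + _ <-]] := lis_ex [::]; case: s. Qed.

Lemma lis_subseq L M : subseq L M -> lis L <= lis M.
Proof.
by move=> LM; have [s [sL srt <-]] := lis_ex L; apply: lis_ge => //; apply: subseq_trans LM.
Qed.

Lemma lis_size L : lis L <= size L.
Proof. by have [s [/size_subseq + _ <-]] := lis_ex L. Qed.

Lemma lis_gt0 L : (0 < lis L) = (0 < size L).
Proof.
case: L => [|x L]; first by rewrite lis_nil.
by apply: (@lis_ge _ [:: x]) => //; rewrite sub1seq mem_head.
Qed.

Lemma lis_cat_size A B : lis (A ++ B) <= lis A + size B.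
Proof.
have [_ [/subseq_cat_inv[s [t [-> sA /size_subseq tB]]] srt <-]] := lis_ex (A ++ B).
rewrite size_cat leq_add // lis_ge //.
by move: srt => /cat_sorted2[].
Qed.

Lemma lis_take_leq j k L : j <= k -> lis (take j L) <= lis (take k L).
Proof. by move=> jk; apply: lis_subseq; rewrite (take_leq_cat _ jk) prefix_subseq. Qed.

Lemma lis_take_le j L : lis (take j L) <= lis L.
Proof. by apply: lis_subseq; apply: take_subseq. Qed.

Lemma lis_take_step j d L : lis (take (j + d) L) <= lis (take j L) + d.
Proof.
rewrite takeD; apply: leq_trans (lis_cat_size _ _) _.
by rewrite leq_add2l size_take; case: ltnP.
Qed.

Lemma lis_rcons_max (L : seq nat) x :
  {in L, forall y, y < x} -> lis (rcons L x) = (lis L).+1.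
Proof.
move=> Lx; apply/eqP; rewrite eqn_leq -{1}addn1 -{1}cats1 lis_cat_size /=.
have [s [sL srt <-]] := lis_ex L; rewrite -(size_rcons s x).
apply: lis_ge; first by rewrite -!cats1; apply: cat_subseq.
by apply: sorted_ltn_rcons => // y /(mem_subseq sL); apply: Lx.
Qed.

(** Weak decrease, phrased by two-term subsequences: it passes to subsequences at once, and it says
    that no ascent is left to complete a 312 behind a larger entry. *)
Definition dec (D : seq nat) := forall b c, subseq [:: b; c] D -> c <= b.

Lemma dec_subseq D E : subseq E D -> dec D -> dec E.
Proof. by move=> ED decD b c bc; apply: decD; apply: subseq_trans ED. Qed.

Lemma dec_cons x D : {in D, forall y, y < x} -> dec D -> dec (x :: D).
Proof.
move=> Dx decD b c /=; case: eqP => [->|_]; last exact: decD.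
by rewrite sub1seq => /Dx /ltnW.
Qed.

Lemma dec_incr_size D s : dec D -> subseq s D -> sorted ltn s -> size s <= 1.
Proof.
case: s => [|b [|c s]] //= decD sD /andP[bc _].
suff: c <= b by rewrite leqNgt bc.
apply: decD; apply: subseq_trans sD.
by rewrite /= !eqxx sub0seq.
Qed.

(** An increasing sequence meets the decreasing part [D] in at most one entry. *)
Lemma lis_cat_dec A D : dec D -> lis (A ++ D) <= (lis A).+1.
Proof.
move=> decD.
have [_ [/subseq_cat_inv[s [t [-> sA tD]]] /cat_sorted2[srts srtt] <-]] := lis_ex (A ++ D).
by rewrite size_cat -addn1 leq_add // ?lis_ge // (dec_incr_size decD).
Qed.

(** * Inserting a new maximum *)

Definition ins (x r : nat) (L : seq nat) := take r L ++ x :: drop r L.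

Lemma size_ins x r L : size (ins x r L) = (size L).+1.
Proof. by rewrite /ins size_cat /= addnS -size_cat cat_take_drop. Qed.

Lemma mem_ins x r L : ins x r L =i x :: L.
Proof.
by move=> y; rewrite -{2}(cat_take_drop r L) !(inE, mem_cat) orbCA.
Qed.

Lemma subseq_ins x r L : subseq L (ins x r L).
Proof. by rewrite -{1}(cat_take_drop r L) /ins cat_subseq // subseq_cons. Qed.

Section Insertion.
Variables (x r : nat) (L : seq nat).
Hypotheses (rL : r <= size L) (Lx : {in L, forall y, y < x}).

Lemma take_ins_le j : j <= r -> take j (ins x r L) = take j L.
Proof.
move=> jr; rewrite /ins takel_cat; first by rewrite take_takel.
by rewrite size_takel // (leq_trans jr).
Qed.

(** The maximum [x] extends every increasing sequence of the first [r] entries; since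
    [x :: drop r L] still decreases, no further gain is possible. *)
Lemma lis_take_ins_gt j : dec (drop r L) -> r < j ->
  lis (take j (ins x r L)) = (lis (take r L)).+1.
Proof.
move=> decL rj; apply/eqP; rewrite eqn_leq; apply/andP; split.
  rewrite (take_leq_cat _ (ltnW rj)) take_ins_le //.
  apply: lis_cat_dec.
  rewrite /ins drop_size_cat ?size_takel //.
  apply: dec_subseq (take_subseq _ _) _.
  by apply: dec_cons => // y /mem_drop; apply: Lx.
apply: leq_trans (lis_take_leq _ rj).
rewrite -(@lis_rcons_max _ x) => [|y /mem_take]; last exact: Lx.
rewrite /ins -cat_rcons takel_cat ?size_rcons ?size_takel //.
by rewrite (@take_oversize _ r.+1) // size_rcons size_takel.
Qed.

(* An increasing sequence longer than those of the first [r] entries ends with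
   one entry of the decreasing part, which may be replaced by its first one. *)
Lemma lis_jump : dec (drop r L) -> lis (take r L) < lis L ->
  lis L <= lis (take r.+1 L).
Proof.
move=> decL lt_lis; have [s [sL srt szs]] := lis_ex L.
move: sL; rewrite -{1}(cat_take_drop r L) => /subseq_cat_inv[s1 [s2 [es s1A s2D]]].
move: srt; rewrite es => srt.
have [srt1 srt2] := cat_sorted2 srt.
have := lis_ge s1A srt1; have := dec_incr_size decL s2D srt2.
move: szs; rewrite es size_cat.
case: s2 s2D {srt2} es srt => [|M [|? ?]] //= sD es srt sz _ le1; first by lia.
case eD: (drop r L) decL sD => [|y D] decL //.
rewrite sub1seq => MD.
have r_lt : r < size L by rewrite ltnNge -subn_eq0 -size_drop eD.
rewrite (take_leq_cat _ (leqnSn r)) subSnn eD /= take0 -sz.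
have -> : size s1 + 1 = size (rcons s1 y) by rewrite size_rcons addn1.
apply: lis_ge; first by rewrite -cats1 cat_subseq.
have My : M <= y.
  by case/predU1P: MD => [->//|MD]; apply: decL; rewrite /= eqxx sub1seq.
apply: sorted_ltn_rcons => // z z1; apply: leq_trans My.
have := srt; rewrite cats1 (sorted_pairwise ltn_trans) pairwise_rcons.
by case/andP => /allP/(_ z z1).
Qed.

(** Undoes an insertion on the level of prefix data. Up to [r] nothing changes; beyond [r] the
    values for [L] have reached [lis L] (by [lis_jump]) and those after the insertion are no
    smaller, so the cut-off restores them. *)
Lemma lis_take_ins j : dec (drop r L) ->
  lis (take j L) = minn (lis (take j (ins x r L))) (lis L).
Proof.
move=> decL; have le_all := lis_take_le j L.
case: (leqP j r) => jr; first by rewrite take_ins_le //; lia.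
rewrite lis_take_ins_gt //.
have le_r := lis_take_leq L (ltnW jr); have le_r1 := lis_take_leq L jr.
have := lis_cat_dec (take r L) decL; rewrite cat_take_drop.
have := lis_jump decL; have := lis_take_le r L; lia.
Qed.

Lemma lis_ins : dec (drop r L) -> lis (ins x r L) = (lis (take r L)).+1.
Proof.
move=> decL.
by rewrite -{1}(@take_oversize _ (size L).+1 (ins x r L)) ?size_ins // lis_take_ins_gt.
Qed.

(** Characterises [r] as the last jump of the prefix values, so the position of the insertion can be
    read off from them. *)
Lemma lis_take_ins_max j : dec (drop r L) ->
  (lis (take j (ins x r L)) == lis (ins x r L)) = (r < j).
Proof.
move=> decL; rewrite lis_ins //.
case: (ltnP r j) => rj; first by rewrite lis_take_ins_gt // eqxx.
by rewrite take_ins_le //; have := lis_take_leq L rj; lia.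
Qed.

End Insertion.

(** * Avoidance of 312 under insertion of a maximum *)

Definition av312 (L : seq nat) :=
  forall a b c, subseq [:: a; b; c] L -> ~ (b < c < a).

Lemma av312_subseq L M : subseq L M -> av312 M -> av312 L.
Proof. by move=> LM avM a b c abc; apply: avM; apply: subseq_trans LM. Qed.

(** An ascent behind [x] would form a 312 with it. *)
Lemma dec_of_av312_ins x r (L : seq nat) : {in L, forall y, y < x} ->
  av312 (ins x r L) -> dec (drop r L).
Proof.
move=> Lx avL b c bc; rewrite leqNgt; apply/negP => lt_bc.
apply: (avL x b c); last first.
  by rewrite lt_bc Lx // (@mem_drop r) // (mem_subseq bc) // !inE eqxx orbT.
by apply: (@cat_subseq _ [::]); rewrite ?sub0seq //= eqxx.
Qed.

(** As the maximum, [x] can only play the 3, and then the other two entries are an ascent in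
    [drop r L]; an occurrence without [x] already lies in [L]. *)
Lemma av312_ins x r (L : seq nat) : {in L, forall y, y < x} -> av312 L -> dec (drop r L) ->
  av312 (ins x r L).
Proof.
move=> Lx avL decL a b c abc /andP[bc ca].
have le_x y : y \in [:: a; b; c] -> y <= x.
  by move=> /(mem_subseq abc); rewrite mem_ins => /predU1P[->|/Lx/ltnW].
have [ax|ax] := eqVneq a x.
  move: abc; rewrite ax => /subseq_cons_notin h.
  suff /h/decL : x \notin take r L by lia.
  by apply/negP => /mem_take /Lx; rewrite ltnn.
apply: (avL a b c) _; last by rewrite bc.
have xL : x \notin L by apply/negP => /Lx; rewrite ltnn.
have -> : L = [seq y <- ins x r L | y != x].
  rewrite /ins filter_cat /= eqxx /= -filter_cat cat_take_drop.
  by apply/esym/all_filterP/allP => y yL; apply: contraNneq xL => <-.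
have -> : [:: a; b; c] = [seq y <- [:: a; b; c] | y != x].
  have a_x := le_x a (mem_head _ _).
  by rewrite /= ax; do 2 (case: eqP; first by lia).
by rewrite subseq_filter filter_all (subseq_trans (filter_subseq _ _)).
Qed.

(* If [b < c] are entries of [drop r L] in this order, all entries before [b]
   are below [c], so [c] extends every increasing sequence of the first [r + 1]
   entries. *)
Lemma dec_of_lis_take r L : uniq L -> av312 L -> lis (take r.+1 L) = lis L ->
  dec (drop r L).
Proof.
move=> uL avL eq_lis b c bc; rewrite leqNgt; apply/negP => lt_bc.
have rL : r < size L.
  by rewrite ltnNge; apply/negP => /drop_oversize E; rewrite E in bc.
rewrite (drop_nth 0 rL) in bc.
have cD : c \in drop r.+1 L.
  move: bc; rewrite /=; case: eqP => _; first by rewrite sub1seq.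
  by move/mem_subseq; apply; rewrite !inE eqxx orbT.
have lt_c : {in take r.+1 L, forall z, z < c}.
  move=> z; rewrite (take_nth 0 rL) mem_rcons inE => /predU1P[->|zr].
    have [<-//|bn] := eqVneq b (nth 0 L r).
    move: bc; rewrite /= (negPf bn) => bc.
    have sub : subseq [:: nth 0 L r; b; c] L.
      rewrite -{2}(cat_take_drop r L) (drop_nth 0 rL).
      by apply: (@cat_subseq _ [::]); rewrite ?sub0seq //= eqxx.
    have := avL _ _ _ sub; have := subseq_uniq sub uL.
    rewrite /= !inE negb_or => /andP[/andP[_ /eqP]]; lia.
  have sub : subseq [:: z; b; c] L.
    rewrite -[X in subseq _ X](cat_take_drop r L) (drop_nth 0 rL) -cat1s.
    rewrite cat_subseq //.
    by rewrite sub1seq.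
  have := avL _ _ _ sub; have := subseq_uniq sub uL.
  rewrite /= !inE negb_or => /andP[/andP[_ /eqP]]; lia.
have : lis (rcons (take r.+1 L) c) <= lis L.
  apply: lis_subseq; rewrite -{2}(cat_take_drop r.+1 L) -cats1 cat_subseq //.
  by rewrite sub1seq.
by rewrite lis_rcons_max // eq_lis ltnn.
Qed.

(** * Insertion processes along a lattice path *)

Definition right_step (v : nat -> vertex) t := v t.+1 = ((v t).1.+1, (v t).2).
Definition down_step (v : nat -> vertex) t := v t = ((v t.+1).1, (v t.+1).2.+1).

Lemma right_down_step_excl v t : right_step v t -> down_step v t -> False.
Proof. by move=> R; rewrite /down_step R => /(congr1 fst) /=; lia. Qed.

Definition steps T v := forall t, t < T -> right_step v t \/ down_step v t.

(** Only the columns of markers are recorded; their rows are recovered later from the down steps at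
    which the entries leave. *)
Definition process T (v : nat -> vertex) (L : nat -> seq nat) :=
  L 0 = [::] /\ forall t, t < T ->
    (right_step v t -> exists2 r, r <= size (L t) & L t.+1 = ins (v t).1 r (L t))
    /\ (down_step v t -> exists z, L t = rcons (L t.+1) z).

(** Each step changes both sides by the same amount. Hence the length of [L t] depends on the path
    alone, which is why N(F,V) does not depend on the placement. *)
Lemma size_process T v L : steps T v -> process T v L -> forall t, t <= T ->
  size (L t) + (v 0).1 + (v 0).2 = (v t).1 + (v t).2.
Proof.
move=> st [L0 pL]; elim=> [|t IH] tT; first by rewrite L0.
have {IH} := IH (ltnW tT); have [R D] := pL t tT.
case: (st t tT) => E.
  by have [? _ ->] := R E; rewrite size_ins E /=; lia.
by have [? ->] := D E; rewrite size_rcons E /=; lia.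
Qed.

Section Process.
Variables (T : nat) (v : nat -> vertex).
Hypothesis stepsv : steps T v.

Lemma process_lt L t : process T v L -> t <= T ->
  {in L t, forall y, y < (v t).1} /\ uniq (L t).
Proof.
case=> L0 stL; elim: t => [|t IH] tT; first by rewrite L0.
have [lt_v uL] := IH (ltnW tT); have [R D] := stL t tT.
case: (stepsv tT) => st.
  have [r _ ->] := R st; split=> [y|].
    by rewrite mem_ins st => /predU1P[->|/lt_v/ltnW].
  rewrite (@perm_uniq _ _ ((v t).1 :: L t)).
    by rewrite /= uL andbT; apply/negP => /lt_v; rewrite ltnn.
  by rewrite /ins perm_catC /= perm_cons perm_catC cat_take_drop.
have [z Lz] := D st; split=> [y yL|].
  by have := lt_v y; rewrite Lz mem_rcons inE yL orbT st; apply.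
by move: uL; rewrite Lz rcons_uniq => /andP[].
Qed.

(** The process is run backwards: the labels and the prefix values of the last word determine the
    prefix values of the word before it. Carrying prefix values as a hypothesis is what makes the
    induction on [t] go through. *)
Lemma process_prefix_lis_uniq L M t : process T v L -> process T v M -> t <= T ->
  (forall i, i <= T -> av312 (L i)) -> (forall i, i <= T -> av312 (M i)) ->
  (forall i, i <= t -> lis (L i) = lis (M i)) ->
  (forall j, lis (take j (L t)) = lis (take j (M t))) ->
  forall i, i <= t -> L i = M i.
Proof.
move=> pL pM + avL avM; elim: t => [|t IH] tT eq_lis eq_pre i.
  by rewrite leqn0 => /eqP->; case: pL pM => -> _ [-> _].
have [RL DL] := pL.2 t tT; have [RM DM] := pM.2 t tT.
have [ltL _] := process_lt pL (ltnW tT); have [ltM _] := process_lt pM (ltnW tT).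
have lis_t := eq_lis t (leqnSn t).
have IHt : (forall j, lis (take j (L t)) = lis (take j (M t))) ->
  forall i, i <= t -> L i = M i.
  by apply: IH (ltnW tT) _ => k kt; apply: eq_lis; apply: leqW.
case: (stepsv tT) => st.
  have [r rL eL] := RL st; have [s sM eM] := RM st.
  have decL : dec (drop r (L t)).
    by apply: (dec_of_av312_ins ltL); rewrite -eL; apply: avL.
  have decM : dec (drop s (M t)).
    by apply: (dec_of_av312_ins ltM); rewrite -eM; apply: avM.
  have eq_t : forall i, i <= t -> L i = M i.
    apply: IHt => j; rewrite (lis_take_ins rL ltL j decL) (lis_take_ins sM ltM j decM).
    by rewrite -eL -eM eq_pre lis_t.
  (* Both positions are the last jump of the same prefix values. *)
  have eq_rs j : (r < j) = (s < j).
    rewrite -(lis_take_ins_max rL ltL j decL) -(lis_take_ins_max sM ltM j decM).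
    by rewrite -eL -eM eq_pre eq_lis.
  rewrite leq_eqVlt => /predU1P[->|]; last exact: eq_t.
  have -> : L t.+1 = M t.+1; last by [].
  rewrite eL eM eq_t //; congr (ins _ _ _).
  by have := eq_rs r.+1; have := eq_rs s.+1; rewrite !ltnS leqnn; lia.
have [z eL] := DL st; have [z' eM] := DM st.
have eq_sz : size (L t.+1) = size (M t.+1).
  by have := size_process stepsv pL tT; have := size_process stepsv pM tT; lia.
(* Prefixes no longer than [L t.+1] survive the down step; any longer prefix is the whole word,
   whose value is the label at [t]. *)
have eq_t : forall i, i <= t -> L i = M i.
  apply: IHt => j; case: (leqP j (size (L t.+1))) => jL.
    by rewrite eL eM -!cats1 !takel_cat // -eq_sz.
  by rewrite !take_oversize // ?eL ?eM size_rcons -?eq_sz.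
rewrite leq_eqVlt => /predU1P[->|]; last exact: eq_t.
have := eq_t t (leqnn t); rewrite eL eM => /eqP.
by rewrite eqseq_rcons => /andP[/eqP].
Qed.

Lemma process_uniq L M : process T v L -> process T v M ->
  (forall i, i <= T -> av312 (L i)) -> (forall i, i <= T -> av312 (M i)) ->
  (forall i, i <= T -> lis (L i) = lis (M i)) -> L T = [::] -> M T = [::] ->
  forall i, i <= T -> L i = M i.
Proof.
move=> pL pM avL avM eq_lis LT MT.
by apply: process_prefix_lis_uniq => // j; rewrite LT MT.
Qed.

(** An insertion never lowers a prefix value, and a down step removes an entry beyond position [m]
    as long as the words keep length at least [m]. *)
Lemma process_lis_take_mono L m i j : process T v L ->
  (forall k, k <= T -> av312 (L k)) -> i <= j -> j <= T ->
  (forall k, i <= k <= j -> m <= size (L k)) ->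
  lis (take m (L i)) <= lis (take m (L j)).
Proof.
move=> pL avL; elim: j => [|j IH]; first by rewrite leqn0 => /eqP->.
rewrite leq_eqVlt => /predU1P[->//|ij] jT le_m.
have {IH} := IH ij (ltnW jT) _; have [R D] := pL.2 j jT.
have [ltL _] := process_lt pL (ltnW jT).
have IHm : forall k, i <= k <= j -> m <= size (L k).
  by move=> k /andP[ik kj]; apply: le_m; rewrite ik leqW.
move/(_ IHm) => /leq_trans; apply.
case: (stepsv jT) => st.
  have [r rL eL] := R st.
  rewrite (lis_take_ins rL ltL m) -?eL; first exact: geq_minl.
  by apply: (dec_of_av312_ins ltL); rewrite -eL; apply: avL.
have [z ->] := D st; rewrite -cats1 takel_cat //.
by apply: le_m; rewrite leqnn andbT leqW.
Qed.

End Process.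

Lemma unit_steps_mono (c : nat -> nat) k :
  (forall j, j < k -> c j <= c j.+1 <= (c j).+1) ->
  forall i j, i <= j -> j <= k -> c i <= c j.
Proof.
move=> st i; elim=> [|j IH]; first by rewrite leqn0 => /eqP->.
rewrite leq_eqVlt => /predU1P[->//|ij] jk.
by have := st j jk; have := IH ij (ltnW jk); lia.
Qed.

(** Supplies the insertion position when the prefix values [c] are prescribed. *)
Lemma unit_steps_last_jump (c : nat -> nat) k :
  (forall j, j <= k -> c j <= c j.+1 <= (c j).+1) -> c 0 < c k.+1 ->
  exists r, [/\ r <= k, (c r).+1 = c k.+1 & forall j, r < j <= k.+1 -> c j = c k.+1].
Proof.
elim: k => [|k IH] st lt0.
  exists 0; split=> //; first by have := st 0 isT; lia.
  by move=> j /andP[j0 j1]; have -> : j = 1 by lia.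
have := st k.+1 (leqnn _) => /andP[le1 le2].
have [eqc|neqc] := eqVneq (c k.+1) (c k.+2).
  have [j jk||r [rk er jr]] := IH; [by apply: st; lia | by rewrite eqc |].
  exists r; split; [lia | by rewrite -eqc|].
  move=> j /andP[rj]; rewrite leq_eqVlt => /predU1P[->//|jk].
  by rewrite -eqc jr ?rj.
exists k.+1; split=> //; first by move: neqc => /eqP; lia.
by move=> j jk; have -> : j = k.+2 by lia.
Qed.

(** * Processes with prescribed labels *)

Section Existence.
Variables (T : nat) (v : nat -> vertex) (N S : nat -> nat).
Hypothesis stepsv : steps T v.
Hypothesis N0 : N 0 = 0.
Hypothesis NR : forall t, t < T -> right_step v t -> N t.+1 = (N t).+1.
Hypothesis ND : forall t, t < T -> down_step v t -> N t = (N t.+1).+1.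
Hypothesis S0 : forall t, t <= T -> N t = 0 -> S t = 0.
Hypothesis S_gt0 : forall t, t <= T -> 0 < N t -> 0 < S t.
Hypothesis SR : forall t, t < T -> right_step v t -> S t.+1 <= (S t).+1.
Hypothesis SD : forall t, t < T -> down_step v t -> S t.+1 <= S t <= (S t.+1).+1.
(** Necessary for labels of a 312-avoiding process: by [process_lis_take_mono] with prefix length
    [N i], the value of the whole word at [i] is at most that of a prefix of the word at [j]. *)
Hypothesis S_diag : forall i j, i <= j -> j <= T ->
  (forall l, i <= l <= j -> N i <= N l) -> S i <= S j.

(* [c] prescribes [lis (take j (L t))], which after a right step at [t]
   determines the same data for [L t]: it is cut off at [S t]. *)
Lemma process_exists_prefix t c : t <= T ->
  c 0 = 0 -> (forall j, 0 < j <= N t -> 0 < c j) ->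
  (forall j, j < N t -> c j <= c j.+1 <= (c j).+1) -> c (N t) = S t ->
  (forall i, i <= t -> (forall l, i <= l <= t -> N i <= N l) -> S i <= c (N i)) ->
  exists L, [/\ process t v L,
    (forall i, i <= t -> [/\ av312 (L i), lis (L i) = S i & size (L i) = N i])
    & forall j, j <= N t -> lis (take j (L t)) = c j].
Proof.
elim: t c => [|t IH] c tT c0 c_gt0 c_step cN c_diag.
  exists (fun=> [::]); split.
  - by split.
  - by move=> i; rewrite leqn0 => /eqP->; rewrite lis_nil N0 S0 ?N0.
  - by move=> j; rewrite N0 leqn0 => /eqP->; rewrite lis_nil c0.
have stepst : steps t v by move=> k kt; apply: stepsv; apply: ltn_trans kt tT.
case: (stepsv tT) => st.
  have Nt1 := NR tT st; rewrite Nt1 in c_gt0 c_step cN.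
  (* Ensures that [c], cut off at [S t], takes exactly the value [S t] at [N t]. *)
  have S_le j : N t <= j -> j <= (N t).+1 -> S t <= c j.
    move=> Nj jN; apply: leq_trans (_ : c (N t) <= _).
      apply: (c_diag t (leqnSn t)) => l; rewrite andbC => /andP[]; rewrite leq_eqVlt.
      case/predU1P => [->|lt1 lt2]; first by rewrite Nt1.
      by have -> : l = t by lia.
    exact: unit_steps_mono c_step _ _ Nj jN.
  have S_st := SR tT st.
  have S_t1 : 0 < S t.+1 by apply: S_gt0 => //; rewrite Nt1.
  pose d j := minn (c j) (S t).
  have [|||||L [pL PL lisL]] := IH d (ltnW tT).
  - by rewrite /d c0 min0n.
  - move=> j /andP[j0 jN]; rewrite /d leq_min c_gt0 ?j0 ?leqW //=.
    by apply: S_gt0; [apply: ltnW | apply: leq_trans jN].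
  - by move=> j jN; have := c_step j (leqW jN); rewrite /d; lia.
  - by rewrite /d; apply/minn_idPr; apply: S_le.
  - move=> i it le_l; rewrite /d leq_min c_diag ?leqW //.
      by apply: S_diag => //; apply: ltnW.
    move=> l /andP[il]; rewrite leq_eqVlt => /predU1P[->|lt]; last by apply: le_l; rewrite il.
    by rewrite Nt1 leqW // le_l // it leqnn.
  have [av_t lis_t sz_t] := PL t (leqnn t).
  have [ltL uL] := process_lt stepst pL (leqnn t).
  (* The new column goes to the last jump of [c]. *)
  have [||r [rN cr cj]] := @unit_steps_last_jump c (N t).
  - by move=> j jN; apply: c_step.
  - by rewrite c0 c_gt0 //= leqnn.
  rewrite cN in cr cj.
  (* If [r < N t], then [c r.+1 = S t.+1 >= S t], so the first [r + 1] entries of [L t] already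
     reach the full value and [dec_of_lis_take] applies. *)
  have decL : dec (drop r (L t)).
    have [->|lt_r] := eqVneq r (N t).
      by rewrite -sz_t drop_size => b c'.
    apply: dec_of_lis_take => //; rewrite lis_t lisL /d; last by lia.
    by apply/minn_idPr; rewrite cj; [rewrite -cN S_le|]; lia.
  have rL : r <= size (L t) by rewrite sz_t.
  have lis_c j : j <= N t.+1 -> lis (take j (ins (v t).1 r (L t))) = c j.
    (* The cut-off is inactive up to [r], because [(c r).+1 = S t.+1 <= (S t).+1]. *)
    rewrite Nt1 => jN; have d_le i : i <= r -> d i = c i.
      move=> ir; apply/minn_idPl.
      apply: leq_trans (unit_steps_mono c_step ir (leqW rN)) _.
      by rewrite -ltnS cr.
    case: (leqP j r) => jr.
      by rewrite take_ins_le // lisL ?d_le // (leq_trans jr).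
    by rewrite lis_take_ins_gt // lisL // d_le // cr cj ?jr.
  exists (fun i => if i == t.+1 then ins (v t).1 r (L t) else L i); split.
  - split; first exact: pL.1.
    move=> k; rewrite ltnS leq_eqVlt => /predU1P[->|kt].
      rewrite eqxx ltn_eqF //; split; first by exists r.
      by move=> Dt; case: (right_down_step_excl st Dt).
    by rewrite !ltn_eqF ?ltnS ?leqW //; [exact: pL.2 | exact: ltnW].
  - move=> i; rewrite leq_eqVlt => /predU1P[->|it]; last by rewrite ltn_eqF //; apply: PL.
    rewrite eqxx; split; first exact: av312_ins.
      rewrite -{1}(@take_oversize _ (N t.+1) (ins _ _ _)) ?size_ins ?sz_t ?Nt1 //.
      by rewrite -Nt1 lis_c // Nt1 cN.
    by rewrite size_ins sz_t Nt1.
  - by rewrite eqxx.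
have Nt := ND tT st.
(* The word before a down step has one more entry, so its only new prefix value is the one of the
   whole word, prescribed as [S t]. *)
pose d j := if j == N t then S t else c j.
have d_c j : j <= N t.+1 -> d j = c j by move=> jN; rewrite /d ltn_eqF ?Nt.
have [|||||L [pL PL lisL]] := IH d (ltnW tT).
- by rewrite d_c.
- move=> j /andP[j0 jN]; rewrite /d; case: eqP => jNt.
    by apply: S_gt0; [apply: ltnW | rewrite Nt].
  by apply: c_gt0; rewrite j0 /=; lia.
- move=> j; rewrite Nt ltnS => jN; rewrite (d_c j jN).
  move: jN; rewrite leq_eqVlt => /predU1P[->|jN].
    by rewrite /d -Nt eqxx cN; apply: SD.
  by rewrite d_c ?c_step.
- by rewrite /d eqxx.
(* If [N i = N t], the bound is [S_diag]. Otherwise [N i <= N t.+1], so the condition on the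
   interval extends to [t.+1] and [c_diag] applies. *)
- move=> i it le_l; rewrite /d; case: eqP => Ni.
    by apply: S_diag => //; apply: ltnW.
  have le_it : N i <= N t by apply: le_l; rewrite it leqnn.
  apply: c_diag; first exact: leqW.
  move=> l /andP[il]; rewrite leq_eqVlt => /predU1P[->|lt]; last by apply: le_l; rewrite il.
  by lia.
have [av_t lis_t sz_t] := PL t (leqnn t).
have sz_take : size (take (N t.+1) (L t)) = N t.+1.
  by rewrite size_takel // sz_t Nt.
exists (fun i => if i == t.+1 then take (N t.+1) (L t) else L i); split.
- split; first exact: pL.1.
  move=> k; rewrite ltnS leq_eqVlt => /predU1P[->|kt].
    rewrite eqxx ltn_eqF //; split; first by move=> Rt; case: (right_down_step_excl Rt st).
    move=> _; exists (nth 0 (L t) (N t.+1)).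
    by rewrite -take_nth ?sz_t ?Nt // -Nt -sz_t take_size.
  by rewrite !ltn_eqF ?ltnS ?leqW //; [exact: pL.2 | exact: ltnW].
- move=> i; rewrite leq_eqVlt => /predU1P[->|it]; last by rewrite ltn_eqF //; apply: PL.
  rewrite eqxx; split=> //; first exact: av312_subseq (take_subseq _ _) av_t.
  by rewrite lisL ?d_c // Nt.
- move=> j jN; rewrite eqxx take_takel // lisL ?d_c //.
  by rewrite Nt leqW.
Qed.

Lemma process_exists : N T = 0 -> exists L, process T v L /\
  forall i, i <= T -> [/\ av312 (L i), lis (L i) = S i & size (L i) = N i].
Proof.
(* The last word is empty, so the zero function prescribes its prefix values. *)
move=> NT; have [||||L [pL PL _]] := @process_exists_prefix T (fun=> 0) (leqnn T) erefl.
- by rewrite NT => j; lia.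
- by [].
- by rewrite S0.
- move=> i iT /(_ T); rewrite iT leqnn NT leqn0 => /(_ isT)/eqP Ni.
  by rewrite S0.
by exists L.
Qed.

End Existence.

(** * Placements as relations between columns and rows *)

(** Relations on naturals make transposition a mere exchange of arguments and free the constructions
    from the size [m] of the array. *)
Definition pts (P : rel nat) (V : vertex) : seq (nat * nat) :=
  sort (fun s t => s.2 <= t.2)
    [seq s <- [seq (x, y) | x <- iota 0 V.1, y <- iota 0 V.2] | P s.1 s.2].

(** Read by increasing row, not from left to right: this lists the inverse of the permutation in the
    definition of avoidance, which turns 231 into 312. *)
Definition cols P V := map fst (pts P V).

Definition rook (P : rel nat) :=
  (forall x y y', P x y -> P x y' -> y = y')
  /\ (forall x x' y, P x y -> P x' y -> x = x').

Definition ne (s t : nat * nat) := (s.1 < t.1) && (s.2 < t.2).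

Definition swap (s : nat * nat) := (s.2, s.1).

Lemma swapK : involutive swap.
Proof. by case. Qed.

Definition flip (P : rel nat) : rel nat := fun x y => P y x.

Lemma mem_pts P V s : (s \in pts P V) = [&& s.1 < V.1, s.2 < V.2 & P s.1 s.2].
Proof.
rewrite mem_sort mem_filter [RHS]andbA [RHS]andbC; congr (_ && _).
case: s => x y /=; apply/allpairsP/andP => /= [[[x' y'] /= []]|[xV yV]].
  by rewrite !mem_iota => /andP[_ xV] /andP[_ yV] [-> ->].
by exists (x, y); rewrite !mem_iota.
Qed.

Lemma rook_flip P : rook P -> rook (flip P).
Proof. by case=> f g; split=> [x y y'|x x' y]; [apply: g | apply: f]. Qed.

Lemma mem_pts_flip P V s : (s \in pts (flip P) (swap V)) = (swap s \in pts P V).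
Proof. by rewrite !mem_pts /= /flip andbCA. Qed.

Lemma below_trans : transitive (relpre (@snd nat nat) ltn).
Proof. by move=> s t u /=; apply: ltn_trans. Qed.

Lemma ne_trans : transitive ne.
Proof. by move=> s t u; rewrite /ne; lia. Qed.

Section Rook.
Variable P : rel nat.
Hypothesis rookP : rook P.

Lemma sorted_pts V : sorted (relpre snd ltn) (pts P V).
Proof.
rewrite -sorted_map ltn_sorted_uniq_leq; apply/andP; split.
  rewrite map_inj_in_uniq; last first.
    move=> [x y] [x' y']; rewrite !mem_pts /= => /and3P[_ _ xy] /and3P[_ _ xy'] eq_y.
    by rewrite -eq_y in xy' *; rewrite (rookP.2 _ _ _ xy xy').
  rewrite sort_uniq filter_uniq // allpairs_uniq ?iota_uniq //.
  by move=> [? ?] [? ?] _ _ [-> ->].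
by rewrite sorted_map; apply: sort_sorted => s t; apply: leq_total.
Qed.

Lemma pts_eq q V : sorted (relpre snd ltn) q -> q =i pts P V -> q = pts P V.
Proof.
move=> srt; apply: (irr_sorted_eq below_trans) => //; last exact: sorted_pts.
by move=> s /=; rewrite ltnn.
Qed.

Lemma subseq_pts q V :
  {subset q <= pts P V} -> sorted (relpre snd ltn) q -> subseq q (pts P V).
Proof.
move=> sub srt; have -> : q = [seq s <- pts P V | s \in q]; last exact: filter_subseq.
apply: (irr_sorted_eq below_trans) => //.
- by move=> s /=; rewrite ltnn.
- by apply: (subseq_sorted below_trans) (sorted_pts V); apply: filter_subseq.
- by move=> s; rewrite mem_filter; case: (boolP (s \in q)) => // /sub ->.
Qed.

Lemma subseq_cols s V : subseq s (cols P V) ->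
  exists q, [/\ s = map fst q, {subset q <= pts P V} & sorted (relpre snd ltn) q].
Proof.
case/subseqP => m _ ->; exists (mask m (pts P V)); rewrite map_mask; split=> //.
  by apply/mem_subseq/mask_subseq.
by apply: (subseq_sorted below_trans) (sorted_pts V); apply: mask_subseq.
Qed.

Lemma chain_le_lis q V : {subset q <= pts P V} -> sorted ne q ->
  size q <= lis (cols P V).
Proof.
move=> sub srt; rewrite -(size_map fst q); apply: lis_ge.
  apply/map_subseq/subseq_pts => //.
  by apply: sub_sorted srt => s t /andP[].
by rewrite sorted_map; apply: sub_sorted srt => s t /andP[].
Qed.

(** A subsequence of [cols P V] lifts to points whose rows increase already, so increasing columns
    make it a chain in both coordinates. *)
Lemma lis_chain V : exists q,
  [/\ {subset q <= pts P V}, sorted ne q & size q = lis (cols P V)].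
Proof.
have [_ [/subseq_cols[q [-> sub srt2]] srt1 <-]] := lis_ex (cols P V).
exists q; rewrite size_map; split=> //.
rewrite sorted_map in srt1; rewrite (sorted_pairwise ne_trans).
have := pairwise_relI (relpre fst ltn) (relpre snd ltn) q; rewrite /ne => ->.
rewrite -!sorted_pairwise ?srt1 //; first exact: below_trans.
by move=> s t u /=; apply: ltn_trans.
Qed.

(** The marker of column [x] has the largest column in the wider rectangle; deleting it leaves the
    word of the narrower one, and its index is the insertion position. *)
Lemma cols_right x b y0 : y0 < b -> P x y0 ->
  exists2 r, r <= size (cols P (x, b)) & cols P (x.+1, b) = ins x r (cols P (x, b)).
Proof.
move=> y0b Pxy0; set L := cols P (x.+1, b).
have -> : cols P (x, b) = [seq z <- L | z < x].
  rewrite /L /cols filter_map; congr map; apply/esym/pts_eq.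
    by apply: (subseq_sorted below_trans) (sorted_pts _); apply: filter_subseq.
  by move=> s; rewrite mem_filter !mem_pts /= andbA; congr (_ && _); lia.
have xL : x \in L.
  by apply/mapP; exists (x, y0); rewrite // mem_pts /= ltnSn y0b.
have uL : uniq L.
  rewrite map_inj_in_uniq.
    by rewrite (sorted_uniq below_trans) ?sorted_pts // => s /=; rewrite ltnn.
  move=> [x1 y1] [x2 y2]; rewrite !mem_pts /= => /and3P[_ _ xy] /and3P[_ _ xy'] eq_x.
  by rewrite -eq_x in xy' *; rewrite (rookP.1 _ _ _ xy xy').
have leL : {in L, forall z, z <= x}.
  by move=> z /mapP[s]; rewrite mem_pts => /andP[+ _] ->.
have eL : L = take (index x L) L ++ x :: drop (index x L).+1 L.
  by rewrite -[LHS](cat_take_drop (index x L)) (drop_nth 0) ?index_mem // nth_index.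
move: uL leL; rewrite {1 2}eL; move: (take _ _) (drop _ _) eL => A B -> uAB leAB.
have notx z : z \in A ++ B -> z < x.
  move=> zAB; rewrite ltn_neqAle leAB; last by rewrite !mem_cat inE orbCA -mem_cat zAB orbT.
  rewrite andbT; apply: contraTneq uAB => <-.
  by rewrite uniq_catC /= mem_cat orbC -mem_cat zAB.
have -> : [seq z <- A ++ x :: B | z < x] = A ++ B.
  rewrite filter_cat /= ltnn -filter_cat; apply/all_filterP/allP => z; exact: notx.
exists (size A); first by rewrite size_cat leq_addr.
by rewrite /ins take_size_cat ?drop_size_cat.
Qed.

Lemma cols_down a x y : x < a -> P x y -> cols P (a, y.+1) = rcons (cols P (a, y)) x.
Proof.
move=> xa Pxy; rewrite /cols -(map_rcons fst _ (x, y)); congr map; apply/esym/pts_eq.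
  rewrite -sorted_map map_rcons; apply: sorted_ltn_rcons; first by rewrite sorted_map sorted_pts.
  by move=> z /mapP[s]; rewrite mem_pts => /and3P[_ + _] ->.
move=> s; rewrite mem_rcons inE !mem_pts /=; apply/predU1P/and3P.
  by case=> [->|/and3P[? ? ?]]; split=> //=; lia.
case: s => x' y' /= [xa' yy' Pxy']; have [eq_y|neq] := eqVneq y' y.
  by left; rewrite eq_y in Pxy' *; rewrite (rookP.2 _ _ _ Pxy Pxy').
by right; rewrite xa' Pxy'; lia.
Qed.

End Rook.

Definition av_231 P V := forall s1 s2 s3,
  s1 \in pts P V -> s2 \in pts P V -> s3 \in pts P V ->
  s1.1 < s2.1 < s3.1 -> ~ (s3.2 < s1.2 < s2.2).

Definition av_312 P V := forall s1 s2 s3,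
  s1 \in pts P V -> s2 \in pts P V -> s3 \in pts P V ->
  s1.1 < s2.1 < s3.1 -> ~ (s2.2 < s3.2 < s1.2).

(** Transposition inverts permutations, and 231 and 312 are inverse to each other. *)
Lemma av_312_flip P V : av_231 (flip P) (swap V) <-> av_312 P V.
Proof.
split=> av s1 s2 s3 h1 h2 h3 h h'.
  by apply: (av (swap s2) (swap s3) (swap s1)); rewrite ?mem_pts_flip ?swapK.
by apply: (av (swap s3) (swap s1) (swap s2)); rewrite -?mem_pts_flip.
Qed.

(** In order of rows, the three points of a 231 are [s3], [s1], [s2], whose columns form a 312. *)
Lemma av_231_cols P V : rook P -> (av_231 P V <-> av312 (cols P V)).
Proof.
move=> rookP; split=> [av a b c abc|av s1 s2 s3 h1 h2 h3 h /andP[h31 h12]].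
  have [q [+ + +]] := subseq_cols rookP abc.
  case: q => [|s [|t [|u [|? ?]]]] //= [-> -> ->] sub /and3P[st tu _].
  move=> ineq; apply: (av t u s) => //; last by rewrite st tu.
  - by apply: sub; rewrite !inE eqxx orbT.
  - by apply: sub; rewrite !inE eqxx !orbT.
  - by apply: sub; rewrite !inE eqxx.
apply: (av s3.1 s1.1 s2.1) => //; apply: (@map_subseq _ _ fst [:: s3; s1; s2]).
apply: subseq_pts => //=; last by rewrite h31 h12.
by move=> s; rewrite !inE => /or3P[] /eqP->.
Qed.

(** Chains of markers stay chains after transposition; applying the inequality to [flip P] as well
    gives equality. *)
Lemma lis_cols_flip P V : rook P -> lis (cols (flip P) (swap V)) = lis (cols P V).
Proof.
have le Q W : rook Q -> lis (cols Q W) <= lis (cols (flip Q) (swap W)).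
  move=> rookQ; have [q [sub srt <-]] := lis_chain rookQ W.
  rewrite -(size_map swap q); apply: chain_le_lis; first exact: rook_flip.
    by move=> _ /mapP[s /sub sQ ->]; rewrite mem_pts_flip; case: s sQ.
  by rewrite sorted_map; apply: sub_sorted srt => s t; rewrite /ne /= andbC.
move=> rookP; apply/eqP; rewrite eqn_leq le // andbT.
by case: V => a b; apply: (le (flip P)); apply: rook_flip.
Qed.

(** * Full placements along a border path *)

(** Fullness read off the path: the marker of a column lies below its right step, that of a row to
    the left of its down step. Along a border path, uniqueness in columns and the last clause then
    confine all markers to the board. *)
Definition full T v P := [/\ rook P,
  forall t, t < T -> right_step v t -> exists2 y, y < (v t).2 & P (v t).1 y,
  forall t, t < T -> down_step v t -> exists2 x, x < (v t.+1).1 & P x (v t.+1).2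
  & forall x y, P x y -> x < (v T).1 /\ y < (v 0).2].

Definition border_path T v := [/\ steps T v, (v 0).1 = 0 & (v T).2 = 0].

Definition reverse_path T (v : nat -> vertex) t := swap (v (T - t)).

Lemma steps_mono T v i j : steps T v -> i <= j -> j <= T ->
  (v i).1 <= (v j).1 /\ (v j).2 <= (v i).2.
Proof.
move=> st; elim: j => [|j IH]; first by rewrite leqn0 => /eqP->.
rewrite leq_eqVlt => /predU1P[->//|ij] jT.
have [le1 le2] := IH ij (ltnW jT).
by case: (st j jT) => E; rewrite /right_step /down_step in E; rewrite E /= in le1 le2 *; lia.
Qed.

Lemma down_step_ex T v y : steps T v -> (v T).2 <= y < (v 0).2 ->
  exists t, [/\ t < T, down_step v t & (v t.+1).2 = y].
Proof.
elim: T => [|T IH] st; first by lia.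
move=> /andP[le lt]; have [yT|Ty] := ltnP y (v T).2; last first.
  have [||t [tT D E]] := IH; [by move=> t tT; apply/st/leqW | by rewrite Ty |].
  by exists t; split=> //; apply: leqW.
exists T; have [E|E] := st T (ltnSn T); first by rewrite E /= in le; lia.
by split=> //; rewrite E /= in yT; lia.
Qed.

(** Step [t] of the transposed path traverses step [T - t.+1] of [v] backwards, hence the shift by
    one. *)
Lemma rev_step T v t : t < T ->
  (right_step (reverse_path T v) t <-> down_step v (T - t.+1)) /\
  (down_step (reverse_path T v) t <-> right_step v (T - t.+1)).
Proof.
move=> tT; rewrite /right_step /down_step /reverse_path.
have -> : (T - t.+1).+1 = T - t by lia.
case: (v (T - t)) (v (T - t.+1)) => [a b] [c d]; rewrite /swap /=.
by split; split=> -[] *; congr (_, _); lia.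
Qed.

Lemma border_path_rev T v : border_path T v -> border_path T (reverse_path T v).
Proof.
case=> st v0 vT; split; rewrite /reverse_path ?subn0 ?subnn //.
move=> t tT; have [R D] := rev_step v tT.
have := st (T - t.+1); case; first by lia.
  by move/D; right.
by move/R; left.
Qed.

Lemma full_flip T v P : full T v P -> full T (reverse_path T v) (flip P).
Proof.
case=> rookP RP DP supp; split; first exact: rook_flip.
- move=> t tT /(rev_step v tT).1 st.
  have [|x xv Px] := DP _ _ st; first by lia.
  have e : (T - t.+1).+1 = T - t by lia.
  by rewrite e in xv Px; exists x.
- move=> t tT /(rev_step v tT).2 st.
  by have [|y yv Py] := RP _ _ st; [lia | exists y].
- by move=> x y /supp[]; rewrite /reverse_path subnn subn0.
Qed.

Lemma eq_full T v v' P : (forall t, t <= T -> v t = v' t) -> full T v P -> full T v' P.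
Proof.
move=> eqv [rookP RP DP supp]; split=> //.
- move=> t tT; rewrite /right_step -!eqv //; [exact: RP | exact: ltnW].
- move=> t tT; rewrite /down_step -!eqv //; [exact: DP | exact: ltnW].
- by rewrite -!eqv.
Qed.

Lemma reverse_pathK T v t : t <= T -> reverse_path T (reverse_path T v) t = v t.
Proof. by move=> tT; rewrite /reverse_path subKn //; case: (v t). Qed.

Lemma full_process T v P : border_path T v -> full T v P ->
  process T v (fun t => cols P (v t)).
Proof.
case=> st v0 _ [rookP RP DP _]; split.
  have := mem_pts P (v 0); rewrite /cols; case: (pts _ _) => [//|s l] /(_ s).
  by rewrite mem_head v0.
move=> t tT; split=> E.
  have [y yv Py] := RP t tT E; rewrite E [v t]surjective_pairing /=.
  exact: cols_right rookP _ _ _ yv Py.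
have [x xv Px] := DP t tT E; exists x; rewrite {1}E /= (cols_down rookP xv Px).
by rewrite -surjective_pairing.
Qed.

Lemma cols_end T v P : border_path T v -> cols P (v T) = [::].
Proof.
case=> _ _ vT; have := mem_pts P (v T); rewrite /cols; case: (pts _ _) => [//|s l] /(_ s).
by rewrite mem_head vT ltn0 andbF.
Qed.

(* A column enters the process at its right step and leaves it for good at some
   down step, whose row receives the marker. *)
Lemma process_full T v L : border_path T v -> process T v L -> L T = [::] ->
  exists2 Q, full T v Q & forall t, t <= T -> cols Q (v t) = L t.
Proof.
move=> bp pL LT; have [st v0 vT] := bp.
(* Row [y] receives the entry removed at the step from height [y.+1] to height [y]. *)
pose Q x y := has (fun t => [&& (v t).2 == y.+1, (v t.+1).2 == y & L t == rcons (L t.+1) x])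
                  (iota 0 T).
have QP x y : reflect (exists t, [/\ t < T, down_step v t, (v t.+1).2 = y
                                  & L t = rcons (L t.+1) x]) (Q x y).
  apply: (iffP hasP) => [[t]|[t [tT D E eL]]].
    rewrite mem_iota => /andP[_ tT] /and3P[/eqP e1 /eqP e2 /eqP eL].
    exists t; split=> //; case: (st t tT) => // R; rewrite R /= in e2; lia.
  by exists t; rewrite ?mem_iota // eL E D /= E !eqxx.
have same_row t1 t2 y : t1 < T -> t2 < T -> down_step v t1 -> down_step v t2 ->
    (v t1.+1).2 = y -> (v t2.+1).2 = y -> t1 = t2.
  move=> t1T t2T D1 D2 E1 E2; case: (ltngtP t1 t2) => // lt12.
    have [_] := steps_mono st lt12 (ltnW t2T); rewrite D2 /=; lia.
  have [_] := steps_mono st lt12 (ltnW t1T); rewrite D1 /=; lia.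
(* Columns inserted from time [i] on are at least [(v i).1], so a smaller entry of [L j] was there
   at time [i]. *)
have old x i j : i <= j -> j <= T -> x < (v i).1 -> x \in L j -> x \in L i.
  elim: j => [|j IH]; first by rewrite leqn0 => /eqP->.
  rewrite leq_eqVlt => /predU1P[->//|ij] jT xi; have [R D] := pL.2 j jT.
  case: (st j jT) => E.
    have [r _ ->] := R E; rewrite mem_ins => /predU1P[ex|]; last exact: IH ij (ltnW jT) xi.
    by have [le _] := steps_mono st (ij : i <= j) (ltnW jT); lia.
  have [z eL] := D E => xL; apply: (IH ij (ltnW jT) xi).
  by rewrite eL mem_rcons inE xL orbT.
have lt_L t z : t < T -> L t = rcons (L t.+1) z -> z < (v t).1 /\ z \notin L t.+1.
  move=> tT eL; have [lt_v] := process_lt st pL (ltnW tT).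
  by rewrite eL rcons_uniq => /andP[zL _]; split=> //; apply: lt_v; rewrite eL mem_rcons mem_head.
have no_repeat t1 t2 x : t1 < t2 -> t2 < T -> down_step v t1 ->
    L t1 = rcons (L t1.+1) x -> L t2 = rcons (L t2.+1) x -> False.
  move=> lt12 t2T D1 e1 e2; have [xv /negP] := lt_L _ _ (ltn_trans lt12 t2T) e1.
  apply; apply: (old x _ _ lt12 (ltnW t2T)); first by rewrite D1 in xv.
  by rewrite e2 mem_rcons mem_head.
have rookQ : rook Q.
  split=> [x y y'|x x' y] /QP[t1 [t1T D1 E1 e1]] /QP[t2 [t2T D2 E2 e2]].
    suff et : t1 = t2 by rewrite -E1 -E2 et.
    case: (ltngtP t1 t2) => // lt12.
      by case: (no_repeat _ _ _ lt12 t2T D1 e1 e2).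
    by case: (no_repeat _ _ _ lt12 t1T D2 e2 e1).
  have et := same_row _ _ _ t1T t2T D1 D2 E1 E2; move: e2; rewrite -et e1 => /eqP.
  by rewrite eqseq_rcons eqxx => /eqP.
have downQ t : t < T -> down_step v t -> exists2 x, x < (v t.+1).1 &
    Q x (v t.+1).2 /\ L t = rcons (L t.+1) x.
  move=> tT D; have [z eL] := (pL.2 t tT).2 D.
  have [zv _] := lt_L _ _ tT eL; exists z; first by rewrite D in zv.
  by split=> //; apply/QP; exists t.
(* Proved backwards from the end of the path, where both words are empty. *)
have colsQ t : t <= T -> cols Q (v t) = L t.
  move=> tT; rewrite -(subKn tT); move: (T - t) (leq_subr t T) => {t tT}.
  elim=> [|d IH] dT; first by rewrite subn0 LT (cols_end _ bp).
  have {IH} := IH (ltnW dT); have tT : T - d.+1 < T by lia.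
  have -> : T - d = (T - d.+1).+1 by lia.
  move: (T - d.+1) tT => {d dT} t tT IH.
  case: (st t tT) => E.
    have [r rL eL] := (pL.2 t tT).1 E.
    have [lt_v _] := process_lt st pL (ltnW tT).
    (* Undoing a right step means discarding the column [(v t).1], for both words alike. *)
    have : [seq z <- cols Q (v t.+1) | z < (v t).1] = [seq z <- L t.+1 | z < (v t).1].
      by rewrite IH.
    rewrite eL /ins filter_cat /= ltnn -filter_cat cat_take_drop.
    have -> : [seq z <- L t | z < (v t).1] = L t.
      by apply/all_filterP/allP => z; apply: lt_v.
    move=> <-; rewrite /cols filter_map; congr map; apply/esym/(pts_eq rookQ).
      by apply: (subseq_sorted below_trans) (sorted_pts rookQ _); apply: filter_subseq.
    by move=> s; rewrite mem_filter !mem_pts E /= andbA; congr (_ && _); lia.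
  have [x xv [Qx eL]] := downQ t tT E.
  by rewrite E (cols_down rookQ xv Qx) -surjective_pairing IH -eL.
exists Q => //; split=> //.
- move=> t tT E; have [r _ eL] := (pL.2 t tT).1 E.
  have : (v t).1 \in cols Q (v t.+1) by rewrite colsQ // eL mem_ins mem_head.
  by case/mapP => -[x y]; rewrite mem_pts E /= => /and3P[_ yv Qxy] ->; exists y.
- by move=> t tT E; have [x xv [Qx _]] := downQ t tT E; exists x.
- move=> x y /QP[t [tT D E eL]].
  have [xv _] := lt_L _ _ tT eL; have [le1 _] := steps_mono st (ltnW tT) (leqnn T).
  have [_] := steps_mono st (leq0n t) (ltnW tT); rewrite D /= E.
  by split=> //; apply: leq_trans xv le1.
Qed.

(** The words along the path agree by [process_uniq], and they determine the placement: the marker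
    of a row sits in the column that its down step removes. *)
Lemma full_uniq T v P Q : border_path T v -> full T v P -> full T v Q ->
  (forall t, t <= T -> av_231 P (v t)) -> (forall t, t <= T -> av_231 Q (v t)) ->
  (forall t, t <= T -> lis (cols P (v t)) = lis (cols Q (v t))) -> P =2 Q.
Proof.
move=> bp fP fQ avP avQ eq_lis; have [st _ vT] := bp.
have [rookP _ _ _] := fP; have [rookQ _ _ _] := fQ.
have eq_cols t : t <= T -> cols P (v t) = cols Q (v t).
  apply: (process_uniq st (full_process bp fP) (full_process bp fQ)) => //.
  - by move=> i iT; apply/av_231_cols => //; apply: avP.
  - by move=> i iT; apply/av_231_cols => //; apply: avQ.
  - exact: cols_end bp.
  - exact: cols_end bp.
have imp P1 P2 : full T v P1 -> full T v P2 ->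
    (forall t, t <= T -> cols P1 (v t) = cols P2 (v t)) -> forall x y, P1 x y -> P2 x y.
  move=> [r1 _ D1 supp1] [r2 _ D2 _] eq12 x y P1xy; have [_ yh] := supp1 _ _ P1xy.
  have [|t [tT D E]] := @down_step_ex T v y st; first by rewrite vT.
  have [x1 x1v P1x] := D1 t tT D; have [x2 x2v P2x] := D2 t tT D.
  have := eq12 t (ltnW tT); rewrite D (cols_down r1 x1v P1x) (cols_down r2 x2v P2x) => /eqP.
  rewrite eqseq_rcons => /andP[_ /eqP e12]; rewrite E in P1x P2x.
  by rewrite (r1.2 _ _ _ P1xy P1x) e12.
by move=> x y; apply/idP/idP; apply: imp => // t tT; rewrite eq_cols.
Qed.

Definition plus N s := if s == 0 then 0 else N + 1 - s.

Lemma full_size T v P t : border_path T v -> full T v P -> t <= T ->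
  size (cols P (v t)) + (v 0).2 = (v t).1 + (v t).2.
Proof.
move=> bp fP tT; have [st v0 _] := bp.
have := size_process st (full_process bp fP) tT; rewrite v0; lia.
Qed.

(** [process_exists] produces 231-avoiding placements, so it is applied to the border of the
    transposed board and the result is transposed back. *)
Lemma full_exists T v P : border_path T v -> full T v P ->
  (forall t, t <= T -> av_231 P (v t)) ->
  exists Q, [/\ full T v Q, forall t, t <= T -> av_312 Q (v t)
    & forall t, t <= T -> lis (cols Q (v t)) = plus (size (cols P (v t))) (lis (cols P (v t)))].
Proof.
move=> bp fP avP; have bp' := border_path_rev bp.
have [st v0 vT] := bp; have [st' _ _] := bp'.
pose L t := cols P (v t); have pL : process T v L := full_process bp fP.
have avL t : t <= T -> av312 (L t).
  by move=> tT; apply/av_231_cols; [case: fP | apply: avP].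
have sz t : t <= T -> size (L t) + (v 0).2 = (v t).1 + (v t).2 := full_size bp fP.
(* Index [t] on the transposed border corresponds to the vertex [v (T - t)]. *)
pose N t := size (L (T - t)); pose S t := plus (N t) (lis (L (T - t))).
have le_sz t := lis_size (L t); have gt0 t := lis_gt0 (L t).
have L0 : L 0 = [::] by case: pL.
have LT : L T = [::] := cols_end _ bp.
have Tsub t : t < T -> (T - t.+1).+1 = T - t by lia.
have LR t : t < T -> right_step v t -> 
    size (L t.+1) = (size (L t)).+1 /\ lis (L t) <= lis (L t.+1) <= (lis (L t)).+1.
  move=> tT R; have [r rL eL] := (pL.2 t tT).1 R.
  have [ltL _] := process_lt st pL (ltnW tT).
  rewrite eL size_ins; split=> //; rewrite lis_subseq ?subseq_ins //=.
  have decL : dec (drop r (L t)).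
    by apply: (dec_of_av312_ins ltL); rewrite -eL; apply: avL.
  by rewrite lis_ins // ltnS lis_take_le.
have LD t : t < T -> down_step v t ->
    size (L t) = (size (L t.+1)).+1 /\ lis (L t.+1) <= lis (L t) <= (lis (L t.+1)).+1.
  move=> tT D; have [z ->] := (pL.2 t tT).2 D; rewrite size_rcons; split=> //.
  rewrite lis_subseq; last by rewrite -cats1 prefix_subseq.
  by have := lis_cat_size (L t.+1) [:: z]; rewrite cats1 addn1.
have [|||||||||M [pM PM]] := @process_exists T (reverse_path T v) N S st'.
- by rewrite /N subn0 LT.
- move=> t tT /(rev_step v tT).1 D; rewrite /N -(Tsub t) //.
  by have [|-> _] := LD _ _ D; first by lia.
- move=> t tT /(rev_step v tT).2 R; rewrite /N -(Tsub t) //.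
  by have [|-> _] := LR _ _ R; first by lia.
- by move=> t tT; rewrite /S /N /plus => Nt; have := le_sz (T - t); case: eqP; lia.
- move=> t tT; rewrite /S /N /plus; have := le_sz (T - t); have := gt0 (T - t).
  by case: eqP; lia.
- move=> t tT /(rev_step v tT).1 D; rewrite /S /N -(Tsub t) //.
  have [|] := LD _ _ D; first by lia.
  move: (T - t.+1) => i; rewrite /plus => e le.
  have := gt0 i; have := gt0 i.+1; have := le_sz i; have := le_sz i.+1.
  by case: eqP; case: eqP; lia.
- move=> t tT /(rev_step v tT).2 D; rewrite /S /N -(Tsub t) //.
  have [|] := LR _ _ D; first by lia.
  move: (T - t.+1) => i; rewrite /plus => e le.
  have := gt0 i; have := gt0 i.+1; have := le_sz i; have := le_sz i.+1.
  by case: eqP; case: eqP; lia.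
(* The first [N i] entries of [L (T - j)] have value at most [lis (L (T - i))], and the other
   [N j - N i] entries add at most one each; so [N - lis] does not decrease from [i] to [j]. *)
- move=> i j ij jT le_l; rewrite /S.
  have le_ij : N i <= N j by apply: le_l; rewrite ij leqnn.
  have := @process_lis_take_mono T v st L (N i) (T - j) (T - i) pL avL _ _ _.
  rewrite -/(N i) [take _ (L (T - i))]take_oversize //.
  have := lis_take_step (N i) (N j - N i) (L (T - j)).
  rewrite subnKC // [take (N j) _]take_oversize // => h1 h2.
  have {}h2 : lis (take (N i) (L (T - j))) <= lis (L (T - i)).
    apply: h2; [lia | lia | move=> k /andP[k1 k2]].
    have -> : k = T - (T - k) by lia.
    by apply: le_l; lia.
  have := gt0 (T - i); have := gt0 (T - j); have := le_sz (T - i); have := le_sz (T - j).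
  by rewrite /plus -/(N i) -/(N j); case: eqP; case: eqP; lia.
- by rewrite /N subnn L0.
have MT : M T = [::].
  have [_ _] := PM T (leqnn T); rewrite /N subnn L0 => /eqP.
  by rewrite size_eq0 => /eqP.
have [Q fQ colsQ] := process_full bp' pM MT; have [rookQ _ _ _] := fQ.
have revE t : t <= T -> swap (v t) = reverse_path T v (T - t).
  by move=> tT; rewrite /reverse_path subKn.
exists (flip Q); split.
- by apply: eq_full (full_flip fQ) => t; apply: reverse_pathK.
- move=> t tT; apply/av_312_flip; rewrite revE //; apply/av_231_cols => //.
  by rewrite colsQ ?leq_subr //; have [] := PM (T - t) (leq_subr _ _).
- move=> t tT; rewrite -lis_cols_flip; last exact: rook_flip.
  rewrite revE // (colsQ (T - t)) ?leq_subr //.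
  have [_ -> _] := PM (T - t) (leq_subr _ _).
  by rewrite /S /N subKn.
Qed.

Lemma uniq_pts P V : rook P -> uniq (pts P V).
Proof.
by move=> rookP; apply: (sorted_uniq below_trans) (sorted_pts rookP V) => s /=; rewrite ltnn.
Qed.

Lemma size_cols_flip P V : rook P -> size (cols (flip P) (swap V)) = size (cols P V).
Proof.
move=> rookP; rewrite !size_map -(size_map swap (pts P V)); apply: perm_size.
apply: uniq_perm; first by apply/uniq_pts/rook_flip.
  by rewrite (map_inj_uniq (inv_inj swapK)) uniq_pts.
by move=> s; rewrite mem_pts_flip -{2}(swapK s) (mem_map (inv_inj swapK)).
Qed.

Lemma full_uniq_312 T v P Q : border_path T v -> full T v P -> full T v Q ->
  (forall t, t <= T -> av_312 P (v t)) -> (forall t, t <= T -> av_312 Q (v t)) ->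
  (forall t, t <= T -> lis (cols P (v t)) = lis (cols Q (v t))) -> P =2 Q.
Proof.
move=> bp fP fQ avP avQ eq_lis x y; have [rookP _ _ _] := fP; have [rookQ _ _ _] := fQ.
apply: (full_uniq (border_path_rev bp) (full_flip fP) (full_flip fQ)) => t tT.
- by apply/av_312_flip/avP; apply: leq_subr.
- by apply/av_312_flip/avQ; apply: leq_subr.
- by rewrite !lis_cols_flip // eq_lis ?leq_subr.
Qed.

(** Obtained from [full_exists] by transposing both the given and the resulting placement. *)
Lemma full_exists_312 T v P : border_path T v -> full T v P ->
  (forall t, t <= T -> av_312 P (v t)) ->
  exists Q, [/\ full T v Q, forall t, t <= T -> av_231 Q (v t)
    & forall t, t <= T -> lis (cols Q (v t)) = plus (size (cols P (v t))) (lis (cols P (v t)))].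
Proof.
move=> bp fP avP; have [rookP _ _ _] := fP.
have revE t : t <= T -> v t = swap (reverse_path T v (T - t)).
  by move=> tT; rewrite /reverse_path subKn ?swapK.
have [|Q [fQ avQ lisQ]] := full_exists (border_path_rev bp) (full_flip fP).
  by move=> t _; apply/av_312_flip; apply: avP; apply: leq_subr.
have [rookQ _ _ _] := fQ; exists (flip Q); split.
- by apply: eq_full (full_flip fQ) => t; apply: reverse_pathK.
- by move=> t tT; rewrite revE //; apply/av_312_flip; apply: avQ; apply: leq_subr.
- move=> t tT; rewrite {1}revE // lis_cols_flip // lisQ ?leq_subr //.
  by rewrite /reverse_path subKn // size_cols_flip // lis_cols_flip.
Qed.

(** For positive [s <= N] the value [N + 1 - s] is again positive, so the case of zero does not
    interfere. *)
Lemma plusK N s : s <= N -> plus N (plus N s) = s.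
Proof. by move=> sN; rewrite /plus; do 2 case: eqP; lia. Qed.

Lemma eq_pts P Q V : P =2 Q -> pts P V = pts Q V.
Proof. by move=> eqPQ; rewrite /pts; congr sort; apply: eq_filter => s; apply: eqPQ. Qed.

Lemma eq_full_rel T v P Q : P =2 Q -> full T v P -> full T v Q.
Proof.
move=> eqPQ [[f g] RP DP supp]; split.
- split=> [x y y'|x x' y]; rewrite -!eqPQ; [exact: f | exact: g].
- by move=> t tT /(RP t tT)[y yv Py]; exists y; rewrite -?eqPQ.
- by move=> t tT /(DP t tT)[y yv Py]; exists y; rewrite -?eqPQ.
- by move=> x y; rewrite -eqPQ; apply: supp.
Qed.

(** * Patterns in words *)

Lemma order_isomorphicP u w :
  reflect (size u = size w /\ forall i j, i < size u -> j < size u ->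
             (nth 0 u i < nth 0 u j) = (nth 0 w i < nth 0 w j))
          (order_isomorphic u w).
Proof.
apply: (iffP andP) => [[/eqP sz /forallP h]|[sz h]]; split=> //.
- move=> i j iu ju.
  by have /forallP/(_ (Ordinal ju))/eqP := h (Ordinal iu).
- by rewrite sz.
- by apply/forallP => i; apply/forallP => j; rewrite h.
Qed.

(** If [x < y], the entry [y] itself is counted for [y] but not for [x]; so [standardize] preserves
    strict comparisons. *)
Lemma count_le_mono (w : seq nat) x y : x \in w -> y \in w ->
  (count (fun z => z <= x) w < count (fun z => z <= y) w) = (x < y).
Proof.
have mono a b : a <= b -> count (fun z => z <= a) w <= count (fun z => z <= b) w.
  by move=> ab; apply: sub_count => z /= /leq_trans; apply.
move=> xw yw; case: (leqP y x) => [yx|xy]; first by rewrite ltnNge mono.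
have : count (predU (fun z => z <= x) (pred1 y)) w <= count (fun z => z <= y) w.
  by apply: sub_count => z /= /orP[/leq_trans->|/eqP->] //; apply: ltnW.
apply: leq_trans; rewrite -addn1.
have -> : count (predU (fun z => z <= x) (pred1 y)) w
        = count (fun z => z <= x) w + count_mem y w.
  rewrite -count_predUI [X in _ + X](@eq_count _ _ pred0) ?count_pred0 ?addn0 //.
  by move=> z /=; case: eqP => [->|]; rewrite ?andbF // andbT leqNgt xy.
by rewrite leq_add2l -has_count has_pred1.
Qed.

Lemma contains_standardizeP tau w :
  (exists u, subseq u w /\ order_isomorphic u tau)
  <-> contains_pattern tau (standardize w).
Proof.
pose f x := count (fun y => y <= x) w.
have iso u : subseq u w -> order_isomorphic (map f u) tau = order_isomorphic u tau.
  move=> /mem_subseq uw; apply/order_isomorphicP/order_isomorphicP;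
    rewrite size_map => -[sz h]; split=> // i j iu ju; rewrite -h //.
    by rewrite !(nth_map 0) // count_le_mono // uw ?mem_nth.
  by rewrite !(nth_map 0) // count_le_mono // uw ?mem_nth.
split=> [[u [uw ut]]|/existsP[b]].
  have /subseqP[b szb eu] := uw; apply/existsP.
  have szb' : size b == size (standardize w) by rewrite size_map szb.
  by exists (Tuple szb'); rewrite /= /standardize -map_mask -eu iso.
rewrite /standardize -map_mask iso ?mask_subseq // => bt.
by exists (mask b w); rewrite mask_subseq.
Qed.

Lemma contains_231P w :
  (exists a b c, subseq [:: a; b; c] w /\ c < a < b)
  <-> contains_pattern pattern231 (standardize w).
Proof.
rewrite -contains_standardizeP; split=> [[a [b [c [sub h]]]]|[u [sub /order_isomorphicP[]]]].
  exists [:: a; b; c]; split=> //; apply/order_isomorphicP; split=> //.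
  by case=> [|[|[|//]]] [|[|[|//]]] _ _ /=; lia.
case: u sub => [|a [|b [|c [|? ?]]]] //= sub _ h; exists a, b, c; split=> //.
by have := h 2 0 isT isT; have := h 0 1 isT isT => /= -> ->.
Qed.

Lemma contains_312P w :
  (exists a b c, subseq [:: a; b; c] w /\ b < c < a)
  <-> contains_pattern pattern312 (standardize w).
Proof.
rewrite -contains_standardizeP; split=> [[a [b [c [sub h]]]]|[u [sub /order_isomorphicP[]]]].
  exists [:: a; b; c]; split=> //; apply/order_isomorphicP; split=> //.
  by case=> [|[|[|//]]] [|[|[|//]]] _ _ /=; lia.
case: u sub => [|a [|b [|c [|? ?]]]] //= sub _ h; exists a, b, c; split=> //.
by have := h 1 2 isT isT; have := h 2 0 isT isT => /= -> ->.
Qed.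

(** * Boards and their borders *)

Section Squares.
Variable m : nat.
Implicit Types (F P Q : {set square m}) (V : vertex).

Definition coords (s : square m) : nat * nat := (s.1 : nat, s.2 : nat).

Lemma coords_inj : injective coords.
Proof. by move=> [i j] [i' j'] [/val_inj-> /val_inj->]. Qed.

Lemma has_squareP P x y :
  reflect (exists2 s, s \in P & coords s = (x, y)) (has_square P x y).
Proof.
apply: (iffP existsP) => [[s /and3P[sP /eqP<- /eqP<-]]|[s sP [<- <-]]]; exists s => //.
by rewrite sP !eqxx.
Qed.

Lemma mem_has_square P s : (s \in P) = has_square P s.1 s.2.
Proof.
apply/idP/has_squareP => [sP|[t tP]]; first by exists s.
by rewrite -[(_, _)]/(coords s) => /coords_inj <-.
Qed.

Lemma has_square_ext P Q : has_square P =2 has_square Q -> P = Q.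
Proof. by move=> eqPQ; apply/setP => s; rewrite !mem_has_square eqPQ. Qed.

Lemma has_square_lt P x y : has_square P x y -> x < m /\ y < m.
Proof. by case/has_squareP => s _ [<- <-]. Qed.

Lemma has_square_set (R : rel nat) : (forall x y, R x y -> x < m /\ y < m) ->
  has_square [set s : square m | R s.1 s.2] =2 R.
Proof.
move=> bound x y; apply/has_squareP/idP => [[s] |Rxy].
  by rewrite inE => Rs [<- <-].
have [xm ym] := bound _ _ Rxy.
by exists (Ordinal xm, Ordinal ym); rewrite ?inE.
Qed.

Definition down_closed F := forall x y x' y',
  has_square F x y -> x' <= x -> y' <= y -> has_square F x' y'.

Lemma ferrers_closed F : ferrers F -> down_closed F.
Proof.
move=> hF x y x' y' /has_squareP[s sF [sx sy]] x'x y'y.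
have x'm : x' < m by apply: leq_ltn_trans x'x _; rewrite -sx.
have y'm : y' < m by apply: leq_ltn_trans y'y _; rewrite -sy.
(* The upper right corner of the square is a vertex whose rectangle contains the whole quadrant
   below. *)
have /hF/subsetP/(_ (Ordinal x'm, Ordinal y'm)) : is_vertex F (x.+1, y.+1).
  by apply/existsP; exists s; rewrite sF -sx -sy !eqxx !orbT.
rewrite inE /= !ltnS x'x y'y => /(_ isT) in_F.
by apply/has_squareP; exists (Ordinal x'm, Ordinal y'm).
Qed.

Lemma height_gt F x y : down_closed F -> has_square F x y -> y < height F.
Proof.
move=> cF Fxy; have [xm ym] := has_square_lt Fxy.
apply: leq_trans (leq_bigmax (Ordinal xm)).
pose f (k : 'I_y.+1) : square m := (Ordinal xm, widen_ord ym k).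
have f_inj : injective f by move=> k l [] /val_inj.
rewrite -[y.+1]card_ord -cardsT -(card_imset _ f_inj) subset_leq_card //.
apply/subsetP => _ /imsetP[k _ ->]; rewrite inE eqxx andbT mem_has_square.
by apply: cF Fxy _ _; rewrite //= -ltnS.
Qed.

Lemma height_ex F y : down_closed F -> y < height F -> has_square F 0 y.
Proof.
move=> cF; apply: contraTT => noF; rewrite -leqNgt; apply/bigmax_leqP => i _.
(* Without the square [(0, y)] no square of [F] lies in row [y] or above, so the rows occurring in a
   column are among the first [y]. *)
set C := [set _ in _ | _]; rewrite cardE -(size_map (fun s : square m => val s.2)).
rewrite -[y in _ <= y](size_iota 0).
apply: uniq_leq_size.
  rewrite map_inj_in_uniq ?enum_uniq // => -[i1 j1] [i2 j2]; rewrite !mem_enum !inE /=.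
  by move=> /andP[_ /eqP->] /andP[_ /eqP->] /val_inj ->.
move=> _ /mapP[s + ->]; rewrite mem_enum inE mem_iota /= add0n => /andP[sF _].
rewrite ltnNge; apply: contra noF => ys.
by apply: (cF s.1 s.2); rewrite -?mem_has_square.
Qed.

(** Reduces the facts on [width] to those on [height]. *)
Definition transpose F := [set s : square m | (s.2, s.1) \in F].

Lemma has_square_transpose F x y : has_square (transpose F) x y = has_square F y x.
Proof.
apply/has_squareP/has_squareP => -[s sF [<- <-]]; exists (s.2, s.1) => //.
  by rewrite inE in sF.
by rewrite inE /= -surjective_pairing.
Qed.

Lemma closed_transpose F : down_closed F -> down_closed (transpose F).
Proof. by move=> cF x y x' y'; rewrite !has_square_transpose => /cF h ? ?; apply: h. Qed.

Lemma width_transpose F : width F = height (transpose F).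
Proof.
apply: eq_bigr => j _.
have inj : injective (fun s : square m => (s.2, s.1)) by move=> [? ?] [? ?] [-> ->].
rewrite -(card_imset _ inj); apply: eq_card => s; rewrite inE.
apply/imsetP/andP => [[t]|[sF sj]].
  by rewrite !inE => /andP[tF tj] ->; rewrite -surjective_pairing.
rewrite inE in sF; exists (s.2, s.1); last by rewrite -surjective_pairing.
by rewrite inE sF.
Qed.

Lemma width_gt F x y : down_closed F -> has_square F x y -> x < width F.
Proof.
move=> cF Fxy; rewrite width_transpose; apply: (@height_gt _ y).
  exact: closed_transpose.
by rewrite has_square_transpose.
Qed.

Lemma width_ex F x : down_closed F -> x < width F -> has_square F x 0.
Proof.
rewrite width_transpose => cF /(height_ex (closed_transpose cF)).
by rewrite has_square_transpose.
Qed.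

Definition border_vertex F t := iter t (border_step F) (0, height F).
Arguments border_vertex : simpl never.

Definition border_length F := width F + height F.

Lemma border_map F : border F = [seq border_vertex F t | t <- iota 0 (border_length F).+1].
Proof.
apply: (@eq_from_nth _ (0, height F)); first by rewrite size_traject size_map size_iota.
rewrite size_traject => i iT.
by rewrite /border nth_traject // (nth_map 0) ?size_iota // nth_iota.
Qed.

Section Board.
Variable F : {set square m}.
Hypothesis cF : down_closed F.
Let v := border_vertex F.
Let T := border_length F.

(** The path keeps just outside the board: the square to the upper right of each vertex is missing.
    Together with the step count, the last invariant shows that height 0 is not reached before time
    [T]. *)
Lemma border_vertex_inv t : t <= T ->
  [/\ (v t).1 + height F = t + (v t).2, (v t).1 <= width F,
      ~~ has_square F (v t).1 (v t).2 & (v t).2 = 0 -> (v t).1 = width F]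
  /\ (t < T -> (right_step v t /\ 0 < (v t).2 /\ has_square F (v t).1 (v t).2.-1)
            \/ (down_step v t /\ ~~ has_square F (v t).1 (v t).2.-1)).
Proof.
have step t' : t' < T ->
  [/\ (v t').1 + height F = t' + (v t').2, (v t').1 <= width F,
      ~~ has_square F (v t').1 (v t').2 & (v t').2 = 0 -> (v t').1 = width F] ->
  (right_step v t' /\ 0 < (v t').2 /\ has_square F (v t').1 (v t').2.-1)
  \/ (down_step v t' /\ ~~ has_square F (v t').1 (v t').2.-1).
  move=> tT [e le_w nF y0].
  (* At height 0 the function [border_step] would stay put, so this has to be excluded before the
     end. *)
  have y_gt0 : 0 < (v t').2.
    by rewrite lt0n; apply/eqP => y_eq0; have := y0 y_eq0; move: tT; rewrite /T /border_length; lia.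
  have vS : v t'.+1 = border_step F (v t') by rewrite /v /border_vertex iterS.
  have [Fx|nFx] := boolP (has_square F (v t').1 (v t').2.-1); [left|right]; split=> //.
    by rewrite /right_step vS /border_step y_gt0 Fx.
  rewrite /down_step vS /border_step (negPf nFx) andbF /= prednK //.
  exact: surjective_pairing.
elim: t => [|t IH] tT.
  suff inv : [/\ (v 0).1 + height F = 0 + (v 0).2, (v 0).1 <= width F,
      ~~ has_square F (v 0).1 (v 0).2 & (v 0).2 = 0 -> (v 0).1 = width F].
    by split=> // /step; apply.
  rewrite /v /border_vertex /=; split=> //.
    by apply/negP => /(height_gt cF); rewrite ltnn.
  (* A board of height 0 has no square, hence width 0. *)
  move=> h0; apply/eqP; rewrite eq_sym -leqn0 leqNgt; apply/negP => /(width_ex cF).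
  by move=> /(height_gt cF); rewrite h0.
suff inv : [/\ (v t.+1).1 + height F = t.+1 + (v t.+1).2, (v t.+1).1 <= width F,
    ~~ has_square F (v t.+1).1 (v t.+1).2 & (v t.+1).2 = 0 -> (v t.+1).1 = width F].
  by split=> // /step; apply.
have [[e le_w nF y0] /(_ tT)] := IH (ltnW tT); case=> [[R [y_gt0 Fx]]|[D nFx]].
  rewrite R /=; split; [lia | exact: width_gt Fx | | by move=> y_eq0; rewrite y_eq0 in y_gt0].
  by apply: contra nF => /cF; apply.
rewrite D /= in e le_w nF nFx; split=> //; first by lia.
move=> y_eq0; rewrite y_eq0 in nFx; apply/eqP; rewrite eqn_leq le_w leqNgt.
by apply: contra nFx; apply: width_ex.
Qed.

Lemma border_start : v 0 = (0, height F).
Proof. by []. Qed.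

Lemma border_end : v T = (width F, 0).
Proof.
have [[e le_w _ _] _] := border_vertex_inv (leqnn T).
by case: (v T) e le_w => a b /=; rewrite /T /border_length => e le_w; congr (_, _); lia.
Qed.

Lemma border_path_board : border_path T v.
Proof.
split=> //; last by rewrite border_end.
by move=> t tT; have [_ /(_ tT)[[]|[]]] := border_vertex_inv (ltnW tT); [left|right].
Qed.

Lemma right_step_square t : t < T -> right_step v t ->
  0 < (v t).2 /\ has_square F (v t).1 (v t).2.-1.
Proof.
move=> tT R; have [_ /(_ tT)[[_ //]|[D _]]] := border_vertex_inv (ltnW tT).
by case: (right_down_step_excl R D).
Qed.

(** A right step is a down step of the transposed path. *)
Lemma right_step_ex x : x < width F -> exists t,
  [/\ t < T, right_step v t & (v t).1 = x].
Proof.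
move=> xw; have bp := border_path_board; have [st' _ _] := border_path_rev bp.
have [|t [tT D E]] := @down_step_ex T (reverse_path T v) x st'.
  by rewrite /reverse_path subnn subn0 border_end.
exists (T - t.+1); split; [lia | exact: (rev_step v tT).2.1 | exact: E].
Qed.

Lemma card_le1_inj P (f : square m -> 'I_m) :
  (forall s t, s \in P -> t \in P -> f s = f t -> s = t) ->
  forall i, #|[set s in P | f s == i]| <= 1.
Proof.
move=> inj i; apply/card_le1_eqP => s t; rewrite !inE => /andP[sP /eqP si] /andP[tP /eqP ti].
by apply: inj; rewrite ?si.
Qed.

(** Columns of [F] correspond to right steps and rows to down steps, so one marker per line of [F]
    amounts to one marker per step. *)
Lemma full_placement_full P : full_placement F P <-> full T v (has_square P).
Proof.
have [st v0 vT] := border_path_board.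
split=> [/andP[/and3P[PF /forallP c1 /forallP c2] /forallP c3]|[rookP RP DP supp]].
  have subF x y : has_square P x y -> has_square F x y.
    by case/has_squareP => s /(subsetP PF) sF e; apply/has_squareP; exists s.
  have inF s : s \in F -> [/\ exists2 t, t \in P & t.1 = s.1 & exists2 t, t \in P & t.2 = s.2].
    move=> sF; have := c3 s; rewrite sF /= => /andP[e1 e2]; split.
      have /card_gt0P[t] : 0 < #|[set t in P | t.1 == s.1]| by rewrite (eqP e1).
      by rewrite inE => /andP[tP /eqP ts]; exists t.
    have /card_gt0P[t] : 0 < #|[set t in P | t.2 == s.2]| by rewrite (eqP e2).
    by rewrite inE => /andP[tP /eqP ts]; exists t.
  split.
  - split=> [x y y'|x x' y] /has_squareP[s sP [s1 s2]] /has_squareP[t tP [t1 t2]].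
      have /card_le1_eqP eq1 := c1 s.1; rewrite -s2 -t2; congr (val _.2).
      by apply: eq1; rewrite inE ?sP ?tP //= -val_eqE /= s1 t1.
    have /card_le1_eqP eq1 := c2 s.2; rewrite -s1 -t1; congr (val _.1).
    by apply: eq1; rewrite inE ?sP ?tP //= -val_eqE /= s2 t2.
  - move=> t tT R; have [y_gt0 /has_squareP[s sF [sx sy]]] := right_step_square tT R.
    have [[u uP us] _] := inF s sF.
    have Pu : has_square P (v t).1 u.2 by apply/has_squareP; exists u; rewrite // /coords us sx.
    have [[_ _ nF _] _] := border_vertex_inv (ltnW tT).
    (* A marker at or above the step would, by down-closure, put the square to the upper right of
       [v t] into [F]. *)
    exists (val u.2) => //; rewrite ltnNge; apply: contra nF => le.
    exact: cF (subF _ _ Pu) _ _.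
  - move=> t tT D.
    have [[_ _ nF _] _] := border_vertex_inv tT.
    have [_] := steps_mono st (leq0n t) (ltnW tT); rewrite border_start D /= => yh.
    have /has_squareP[s sF [_ sy]] := height_ex cF yh.
    have [_ [u uP us]] := inF s sF.
    have Pu : has_square P u.1 (v t.+1).2 by apply/has_squareP; exists u; rewrite // /coords us sy.
    exists (val u.1) => //; rewrite ltnNge; apply: contra nF => le.
    exact: cF (subF _ _ Pu) _ _.
  - by move=> x y /subF Fxy; rewrite border_start border_end (width_gt cF Fxy) (height_gt cF Fxy).
(* The right step over the column of [s] has a marker below it, which must be [s]. *)
have PF s : s \in P -> s \in F.
  rewrite !mem_has_square => Ps; have [+ _] := supp _ _ Ps; rewrite border_end => sw.
  have [t [tT R E]] := right_step_ex sw; have [y_gt0 Fx] := right_step_square tT R.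
  have [y yv Py] := RP t tT R; rewrite E in Fx Py; rewrite -(rookP.1 _ _ _ Py Ps).
  by apply: cF Fx _ _; rewrite // -ltnS prednK.
have inj1 s t : s \in P -> t \in P -> s.1 = t.1 -> s = t.
  case: s t => [i j] [i' j']; rewrite !mem_has_square /= => sP tP e.
  by rewrite -e in tP *; congr (_, _); apply/val_inj/(rookP.1 _ _ _ sP tP).
have inj2 s t : s \in P -> t \in P -> s.2 = t.2 -> s = t.
  case: s t => [i j] [i' j']; rewrite !mem_has_square /= => sP tP e.
  by rewrite -e in tP *; congr (_, _); apply/val_inj/(rookP.2 _ _ _ sP tP).
have le1 := card_le1_inj inj1; have le2 := card_le1_inj inj2.
apply/andP; split.
  apply/and3P; split; first by apply/subsetP.
    by apply/forallP => i; apply: le1.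
  by apply/forallP => i; apply: le2.
apply/forallP => s; apply/implyP => sF; rewrite !eqn_leq le1 le2 /=.
rewrite mem_has_square in sF; apply/andP; split; apply/card_gt0P.
  have [t [tT R E]] := right_step_ex (width_gt cF sF).
  have [y _ /has_squareP[u uP [u1 _]]] := RP t tT R.
  by exists u; rewrite inE uP -val_eqE /= u1 E.
have [|t [tT D E]] := @down_step_ex T v s.2 st.
  by rewrite vT border_start (height_gt cF sF).
have [x _ /has_squareP[u uP [_ u2]]] := DP t tT D.
by exists u; rewrite inE uP -val_eqE /= u2 E.
Qed.

End Board.

(** * Translation of markers, labels and patterns into point lists *)

Lemma mem_pts_coords P V s :
  (coords s \in pts (has_square P) V) = (s \in P :&: rect m V).
Proof. by rewrite mem_pts /= -mem_has_square !inE andbA andbC. Qed.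

Lemma pts_coords P V : pts (has_square P) V =i [seq coords s | s <- enum (P :&: rect m V)].
Proof.
move=> s; apply/idP/mapP => [sV|[t]]; last by rewrite mem_enum -mem_pts_coords => tP ->.
have := sV; rewrite mem_pts => /and3P[_ _ /has_squareP[t _ e]].
by exists t; rewrite ?mem_enum -?mem_pts_coords e -surjective_pairing.
Qed.

Lemma lift_coords P V q : {subset q <= pts (has_square P) V} ->
  exists2 q', q = map coords q' & {subset q' <= P :&: rect m V}.
Proof.
elim: q => [|s q IH] sub; first by exists [::].
have [|q' -> sub'] := IH; first by move=> t tq; apply: sub; rewrite inE tq orbT.
have := sub s (mem_head _ _); rewrite pts_coords => /mapP[t]; rewrite mem_enum => tP ->.
by exists (t :: q') => // u; rewrite inE => /predU1P[->|/sub'].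
Qed.

Lemma north_east_coords q : sorted (@north_east m) q = sorted ne (map coords q).
Proof. by rewrite sorted_map. Qed.

Lemma max_increasing_lis P V : rook (has_square P) ->
  max_increasing P V = lis (cols (has_square P) V).
Proof.
move=> rookP; apply/eqP; rewrite eqn_leq; apply/andP; split.
  apply/bigmax_leqP => k /existsP[q /andP[/allP qP srt]].
  rewrite -(size_tuple q) -(size_map coords); apply: chain_le_lis => //.
    by move=> _ /mapP[s /qP sP ->]; rewrite mem_pts_coords.
  by rewrite -north_east_coords.
have [q [sub srt <-]] := lis_chain rookP V.
have [q' eq sub'] := lift_coords sub; rewrite eq size_map.
rewrite eq -north_east_coords in srt.
(* A chain has no repetition, so its length respects the bound on the index of the maximum. *)
have uq : uniq q'.
  apply: sorted_uniq srt => [s t u|s]; rewrite /north_east; last by rewrite ltnn.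
  by move=> /andP[h1 h2] /andP[h3 h4]; rewrite (ltn_trans h1 h3) (ltn_trans h2 h4).
have szq : size q' < #|P :&: rect m V|.+1.
  by rewrite ltnS cardE; apply: uniq_leq_size => // s /sub'; rewrite mem_enum.
apply: (@leq_bigmax_cond _ _ _ (Ordinal szq)); apply/existsP.
by exists (in_tuple q'); rewrite srt andbT; apply/allP.
Qed.

Lemma size_cols_card P V : rook (has_square P) ->
  size (cols (has_square P) V) = #|P :&: rect m V|.
Proof.
move=> rookP; rewrite size_map cardE -(size_map coords); apply: perm_size.
apply: uniq_perm; first exact: uniq_pts.
  by rewrite (map_inj_uniq coords_inj) enum_uniq.
exact: pts_coords.
Qed.

(** Heights from left to right are the columns of the transposed placement by increasing row. The
    sorting order is only weak, but with at most one marker per column the sorted list is unique. *)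
Lemma marker_word_cols P V : rook (has_square P) ->
  marker_word (P :&: rect m V) = cols (flip (has_square P)) (swap V).
Proof.
move=> rookP; have rookP' := rook_flip rookP.
rewrite /marker_word; set l := sort _ _.
have -> : [seq nat_of_ord s.2 | s <- l] = map fst (map (swap \o coords) l) by rewrite -map_comp.
congr map; apply: (pts_eq rookP') => [|s]; last first.
  rewrite -(swapK s); move: (swap s) => {}s.
  rewrite mem_pts_flip swapK pts_coords map_comp (mem_map (inv_inj swapK)).
  by apply: eq_mem_map => t; rewrite mem_sort.
rewrite -sorted_map -map_comp ltn_sorted_uniq_leq; apply/andP; split.
  rewrite map_inj_in_uniq ?sort_uniq ?enum_uniq // => s t.
  rewrite !mem_sort !mem_enum !inE !mem_has_square => /andP[sP _] /andP[tP _].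
  case: s t sP tP => [i j] [i' j'] /= sP tP /val_inj e.
  by rewrite -e in tP *; congr (_, _); apply/val_inj/(rookP.1 _ _ _ sP tP).
by rewrite sorted_map; apply: sort_sorted => s t; apply: leq_total.
Qed.

Lemma av_231_contains P V : rook (has_square P) ->
  (av_231 (has_square P) V
   <-> ~~ contains_pattern pattern231 (standardize (marker_word (P :&: rect m V)))).
Proof.
move=> rookP; have rookP' := rook_flip rookP; rewrite marker_word_cols //; split.
  move=> av; apply/negP => /contains_231P[a [b [c [/(subseq_cols rookP')[q [+ + +]]]]]].
  case: q => [|s1 [|s2 [|s3 [|? ?]]]] //= [-> -> ->] sub /and3P[lt12 lt23 _] h.
  apply: (av (swap s1) (swap s2) (swap s3)) => //=; rewrite -?mem_pts_flip ?swapK;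
    by [rewrite lt12 | apply: sub; rewrite !inE eqxx ?orbT].
move=> /negP nc s1 s2 s3 h1 h2 h3 /andP[lt12 lt23] h; apply: nc.
apply/contains_231P; exists s1.2, s2.2, s3.2; split=> //.
apply: (@map_subseq _ _ fst [:: swap s1; swap s2; swap s3]).
apply: (subseq_pts rookP') => /=; last by rewrite lt12 lt23.
by move=> s; rewrite !inE => /or3P[] /eqP->; rewrite mem_pts_flip swapK.
Qed.

Lemma av_312_contains P V : rook (has_square P) ->
  (av_312 (has_square P) V
   <-> ~~ contains_pattern pattern312 (standardize (marker_word (P :&: rect m V)))).
Proof.
move=> rookP; have rookP' := rook_flip rookP; rewrite marker_word_cols //; split.
  move=> av; apply/negP => /contains_312P[a [b [c [/(subseq_cols rookP')[q [+ + +]]]]]].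
  case: q => [|s1 [|s2 [|s3 [|? ?]]]] //= [-> -> ->] sub /and3P[lt12 lt23 _] h.
  apply: (av (swap s1) (swap s2) (swap s3)) => //=; rewrite -?mem_pts_flip ?swapK;
    by [rewrite lt12 | apply: sub; rewrite !inE eqxx ?orbT].
move=> /negP nc s1 s2 s3 h1 h2 h3 /andP[lt12 lt23] h; apply: nc.
apply/contains_312P; exists s1.2, s2.2, s3.2; split=> //.
apply: (@map_subseq _ _ fst [:: swap s1; swap s2; swap s3]).
apply: (subseq_pts rookP') => /=; last by rewrite lt12 lt23.
by move=> s; rewrite !inE => /or3P[] /eqP->; rewrite mem_pts_flip swapK.
Qed.

(** * The bijections *)

Section Bijection.
Variable F : {set square m}.
Hypothesis cF : down_closed F.
Let v := border_vertex F.
Let T := border_length F.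
Let bp : border_path T v := border_path_board cF.

Lemma all_border (a : pred vertex) : all a (border F) <-> forall t, t <= T -> a (v t).
Proof.
rewrite border_map all_map; split=> [/allP h t tT|h]; first by apply: h; rewrite mem_iota.
by apply/allP => t; rewrite mem_iota => tT; apply: h.
Qed.

Lemma avoiders_231P P : P \in avoiders F pattern231 <->
  full T v (has_square P) /\ forall t, t <= T -> av_231 (has_square P) (v t).
Proof.
rewrite inE; split=> [/andP[/(full_placement_full cF) fP /all_border avP]|[fP avP]].
  split=> // t tT; have [rookP _ _ _] := fP; apply/av_231_contains => //; exact: avP.
have [rookP _ _ _] := fP; apply/andP; split; first exact/(full_placement_full cF).
by apply/all_border => t tT; apply/av_231_contains => //; apply: avP.
Qed.

Lemma avoiders_312P P : P \in avoiders F pattern312 <->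
  full T v (has_square P) /\ forall t, t <= T -> av_312 (has_square P) (v t).
Proof.
rewrite inE; split=> [/andP[/(full_placement_full cF) fP /all_border avP]|[fP avP]].
  split=> // t tT; have [rookP _ _ _] := fP; apply/av_312_contains => //; exact: avP.
have [rookP _ _ _] := fP; apply/andP; split; first exact/(full_placement_full cF).
by apply/all_border => t tT; apply/av_312_contains => //; apply: avP.
Qed.

Lemma S_seq_lis P : full T v (has_square P) ->
  S_seq F P = [seq lis (cols (has_square P) (v t)) | t <- iota 0 T.+1].
Proof.
case=> rookP _ _ _; rewrite /S_seq border_map -map_comp; apply: eq_map => t /=.
exact: max_increasing_lis.
Qed.

(** The placement picked in [marker_count] is arbitrary; by [full_size] all full placements give the
    same count. *)
Lemma marker_count_size P t : full T v (has_square P) -> t <= T ->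
  marker_count F (v t) = size (cols (has_square P) (v t)).
Proof.
move=> fP tT; rewrite /marker_count; case: pickP => [Q fQ|/(_ P)]; last first.
  by have /(full_placement_full cF) -> := fP.
have {}fQ := (full_placement_full cF Q).1 fQ; have [rookQ _ _ _] := fQ.
rewrite -size_cols_card //.
by have := full_size bp fP tT; have := full_size bp fQ tT; lia.
Qed.

Lemma S_plus_map P (f : nat -> nat) : full T v (has_square P) ->
  S_plus F [seq f t | t <- iota 0 T.+1]
  = [seq plus (size (cols (has_square P) (v t))) (f t) | t <- iota 0 T.+1].
Proof.
move=> fP; rewrite /S_plus border_map zip_map -map_comp.
apply/eq_in_map => t; rewrite mem_iota /= add0n ltnS => tT.
by rewrite (marker_count_size fP tT).
Qed.

Lemma S_plusK P : full_placement F P -> S_plus F (S_plus F (S_seq F P)) = S_seq F P.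
Proof.
move=> /(full_placement_full cF) fP; rewrite S_seq_lis // !(S_plus_map _ fP).
by apply: eq_map => t; rewrite plusK // lis_size.
Qed.

Lemma S_seq_eq P Q : full T v (has_square P) -> full T v (has_square Q) ->
  S_seq F P = S_seq F Q -> forall t, t <= T ->
  lis (cols (has_square P) (v t)) = lis (cols (has_square Q) (v t)).
Proof.
by move=> fP fQ; rewrite !S_seq_lis // => /eq_in_map h t tT; apply: h; rewrite mem_iota.
Qed.

Lemma realize (R : rel nat) P : full T v R -> full T v (has_square P) ->
  (forall t, t <= T ->
     lis (cols R (v t))
     = plus (size (cols (has_square P) (v t))) (lis (cols (has_square P) (v t)))) ->
  exists Q, has_square Q =2 R /\ S_seq F Q = S_plus F (S_seq F P).
Proof.
move=> fR fP lisR.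
(* [R] stays inside the bounding box of [F], so it comes from a set of squares of the array. *)
have bound x y : R x y -> x < m /\ y < m.
  case: fR => _ _ _ supp /supp[]; rewrite [v T](border_end cF) /= => xw yh.
  have [xm _] := has_square_lt (width_ex cF xw).
  by have [_ ym] := has_square_lt (height_ex cF yh).
have eqR := has_square_set bound; exists [set s : square m | R s.1 s.2]; split=> //.
have eqR' : R =2 has_square [set s : square m | R s.1 s.2] by move=> x y; rewrite eqR.
rewrite !S_seq_lis //; last exact: eq_full_rel eqR' fR.
rewrite (S_plus_map _ fP); apply/eq_in_map => t; rewrite mem_iota /= add0n ltnS => tT.
by rewrite -lisR // /cols (eq_pts _ eqR).
Qed.

Lemma avoiders_231_uniq : {in avoiders F pattern231 &, injective (S_seq F)}.
Proof.
move=> P Q /avoiders_231P[fP avP] /avoiders_231P[fQ avQ] eqS; apply: has_square_ext.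
exact: full_uniq bp fP fQ avP avQ (S_seq_eq fP fQ eqS).
Qed.

Lemma avoiders_312_uniq : {in avoiders F pattern312 &, injective (S_seq F)}.
Proof.
move=> P Q /avoiders_312P[fP avP] /avoiders_312P[fQ avQ] eqS; apply: has_square_ext.
exact: full_uniq_312 bp fP fQ avP avQ (S_seq_eq fP fQ eqS).
Qed.

Lemma avoiders_312_exists : {in avoiders F pattern231, forall P,
  exists2 Q, Q \in avoiders F pattern312 & S_seq F Q = S_plus F (S_seq F P)}.
Proof.
move=> P /avoiders_231P[fP avP]; have [R [fR avR lisR]] := full_exists bp fP avP.
have [Q [eqR eqS]] := realize fR fP lisR; exists Q => //; apply/avoiders_312P; split.
  by apply: eq_full_rel fR => x y; rewrite eqR.
by move=> t tT; rewrite /av_312 (eq_pts _ eqR); apply: avR.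
Qed.

Lemma avoiders_231_exists : {in avoiders F pattern312, forall P,
  exists2 Q, Q \in avoiders F pattern231 & S_seq F Q = S_plus F (S_seq F P)}.
Proof.
move=> P /avoiders_312P[fP avP]; have [R [fR avR lisR]] := full_exists_312 bp fP avP.
have [Q [eqR eqS]] := realize fR fP lisR; exists Q => //; apply/avoiders_231P; split.
  by apply: eq_full_rel fR => x y; rewrite eqR.
by move=> t tT; rewrite /av_231 (eq_pts _ eqR); apply: avR.
Qed.

End Bijection.

(** Injectivity makes the selected set a singleton, so the default [set0] is not returned. *)
Lemma the_placementP (X : {set {set square m}}) (f : {set square m} -> seq nat) (s : seq nat) :
  {in X &, injective f} -> (exists2 Q, Q \in X & f Q = s) ->
  the_placement [set Q in X | f Q == s] \in X
  /\ f (the_placement [set Q in X | f Q == s]) = s.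
Proof.
move=> inj [Q QX fQ]; have -> : [set Q in X | f Q == s] = [set Q].
  apply/setP => R; rewrite !inE; apply/andP/eqP => [[RX /eqP fR]|->]; last by rewrite QX fQ.
  by apply: inj; rewrite ?fR.
by rewrite /the_placement set1K.
Qed.

End Squares.

Theorem theorem3 (m : nat) (F : {set square m}) (hF : ferrers F) :
  (* alpha : S_F(231) -> S_F(312) and beta : S_F(312) -> S_F(231), with their
     defining equations *)
  [/\ {in avoiders F pattern231, forall P,
         alpha F P \in avoiders F pattern312
         /\ S_seq F (alpha F P) = S_plus F (S_seq F P)}
    & {in avoiders F pattern312, forall P,
         beta F P \in avoiders F pattern231
         /\ S_seq F (beta F P) = S_plus F (S_seq F P)}] /\
  (* they are inverses of each other *)
  [/\ {in avoiders F pattern231, cancel (alpha F) (beta F)}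
    & {in avoiders F pattern312, cancel (beta F) (alpha F)}] /\
  (* both are bijections *)
  [/\ {in avoiders F pattern231 &, injective (alpha F)},
      alpha F @: avoiders F pattern231 = avoiders F pattern312,
      {in avoiders F pattern312 &, injective (beta F)}
    & beta F @: avoiders F pattern312 = avoiders F pattern231].
Proof.
have cF := ferrers_closed hF.
have inj231 := avoiders_231_uniq cF; have inj312 := avoiders_312_uniq cF.
have alphaP : {in avoiders F pattern231, forall P,
    alpha F P \in avoiders F pattern312 /\ S_seq F (alpha F P) = S_plus F (S_seq F P)}.
  by move=> P PF; apply: the_placementP (avoiders_312_exists cF PF).
have betaP : {in avoiders F pattern312, forall P,
    beta F P \in avoiders F pattern231 /\ S_seq F (beta F P) = S_plus F (S_seq F P)}.
  by move=> P PF; apply: the_placementP (avoiders_231_exists cF PF).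
have full_av tau P : P \in avoiders F tau -> full_placement F P by rewrite inE => /andP[].
(* The round trip yields a 231-avoiding placement with labels [S_plus] applied twice, that is, those
   of [P]; labels determine the placement. *)
have alphaK : {in avoiders F pattern231, cancel (alpha F) (beta F)}.
  move=> P PF; have [aF aS] := alphaP P PF; have [bF bS] := betaP _ aF.
  by apply: inj231 => //; rewrite bS aS (S_plusK cF) // (full_av _ _ PF).
have betaK : {in avoiders F pattern312, cancel (beta F) (alpha F)}.
  move=> P PF; have [bF bS] := betaP P PF; have [aF aS] := alphaP _ bF.
  by apply: inj312 => //; rewrite aS bS (S_plusK cF) // (full_av _ _ PF).
do 2 split=> //; split; [exact: can_in_inj alphaK | | exact: can_in_inj betaK |].
  apply/setP => Q; apply/imsetP/idP => [[P /alphaP[aF _] ->] //|QF].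
  by exists (beta F Q); [case: (betaP Q QF) | rewrite betaK].
apply/setP => Q; apply/imsetP/idP => [[P /betaP[bF _] ->] //|QF].
by exists (alpha F Q); [case: (alphaP Q QF) | rewrite alphaK].
Qed.
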